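(* Let $\omega$ be a majorant and let $f$ be a harmonic mapping in the unit disk $\mathbb{D}$. Then the following two conditions are equivalent: (i) there is a constant $M>0$ such that $\Lambda_f(z)\le M\,\omega\!\left(\frac{1}{d(z)}\right)$ for all $z\in\mathbb{D}$; (ii) there is a constant $M>0$ such that for all $z\in\mathbb{D}$ and every $r\in(0,1-|z|]$, $$\frac{1}{|\mathbb{D}(z,r)|}\int_{\mathbb{D}(z,r)}|f(\zeta)-f(z)|\,dA(\zeta)\le M\,r\,\omega\!\left(\frac1r\right).$$ (The constants $M$ in (i) and (ii) need not be the same.)
   Context: $\mathbb{D}=\{z\in\mathbb{C}:|z|<1\}$ and $\mathbb{D}(z,r)=\{\zeta\in\mathbb{C}:|\zeta-z|<r\}$; $dA$ is area (Lebesgue) measure and $|\mathbb{D}(z,r)|=\pi r^2$ is the area of the disk. A harmonic mapping in $\mathbb{D}$ is a complex-valued function on $\mathbb{D}$ whose real and imaginary parts are real harmonic functions. $\Lambda_f(z)=|f_z(z)|+|f_{\overline z}(z)|$, with $f_z,f_{\overline z}$ the Wirtinger derivatives. $d(z)=1-|z|$ is the Euclidean distance from $z$ to $\partial\mathbb{D}$. A majorant is a continuous increasing function $\omega:[0,\infty)\to[0,\infty)$ with $\omega(0)=0$ such that $\omega(t)/t$ is non-increasing for $t>0$. *)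

(* Defs.v *)
From HB Require Import structures.
From mathcomp Require Import all_boot all_order all_algebra.
From mathcomp Require Import all_classical all_reals all_analysis.
From mathcomp Require Import complex.

Set Implicit Arguments.
Unset Strict Implicit.
Unset Printing Implicit Defensive.

Import Order.TTheory GRing.Theory Num.Theory.
Import numFieldNormedType.Exports.

Local Open Scope classical_set_scope.
Local Open Scope complex_scope.
Local Open Scope ring_scope.

Section Plane.
Variable R : realType.

(* [R * R] carries the topology, derivatives and Lebesgue measure of the plane;
   [R[i]] carries the complex arithmetic. *)
Definition toC (p : R * R) : R[i] := p.1 +i* p.2.
Definition ofC (z : R[i]) : R * R := (complex.Re z, complex.Im z).

(* Modulus with values in [R]; [`|z|] on [R[i]] takes values in [R[i]]. *)
Definition cabs (z : R[i]) : R := Normc.normc z.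

Definition disk (z : R[i]) (r : R) : set R[i] := [set w | cabs (w - z) < r].
Definition unit_disk : set R[i] := [set z | cabs z < 1].

Definition ex : R * R := (1, 0).
Definition ey : R * R := (0, 1).

(* C^k on [U], to be used for open [U]: all partial derivatives of order at
   most [k] exist and are continuous at the points of [U]. *)
Fixpoint Ck (k : nat) (U : set (R * R)) (u : R * R -> R) : Prop :=
  (forall p, U p -> {for p, continuous u}) /\
  if k is k'.+1 then
    [/\ forall p, U p -> derivable u p ex,
        forall p, U p -> derivable u p ey,
        Ck k' U ('D_ex u) & Ck k' U ('D_ey u)]
  else True.

Definition laplacian (u : R * R -> R) (p : R * R) : R :=
  'D_ex ('D_ex u) p + 'D_ey ('D_ey u) p.

Definition real_harmonic (U : set (R * R)) (u : R * R -> R) : Prop :=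
  Ck 2 U u /\ forall p, U p -> laplacian u p = 0.

Definition re_part (f : R[i] -> R[i]) (p : R * R) : R := complex.Re (f (toC p)).
Definition im_part (f : R[i] -> R[i]) (p : R * R) : R := complex.Im (f (toC p)).

(* The values of [f] outside the open set [D] play no role. *)
Definition harmonic_mapping (D : set R[i]) (f : R[i] -> R[i]) : Prop :=
  real_harmonic (toC @^-1` D) (re_part f) /\
  real_harmonic (toC @^-1` D) (im_part f).

Definition partial (v : R * R) (f : R[i] -> R[i]) (z : R[i]) : R[i] :=
  'D_v (re_part f) (ofC z) +i* 'D_v (im_part f) (ofC z).

Definition wirtinger (f : R[i] -> R[i]) (z : R[i]) : R[i] :=
  (partial ex f z - (0 +i* 1) * partial ey f z) / 2.
Definition wirtinger_bar (f : R[i] -> R[i]) (z : R[i]) : R[i] :=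
  (partial ex f z + (0 +i* 1) * partial ey f z) / 2.

Definition Lambda (f : R[i] -> R[i]) (z : R[i]) : R :=
  cabs (wirtinger f z) + cabs (wirtinger_bar f z).

Definition bdist (z : R[i]) : R := 1 - cabs z.

Definition planeLebesgue := (@lebesgue_measure R \x @lebesgue_measure R)%E.

Definition area (A : set R[i]) : \bar R := planeLebesgue (toC @^-1` A).

Definition area_integral (A : set R[i]) (g : R[i] -> R) : \bar R :=
  (\int[planeLebesgue]_(p in toC @^-1` A) (g (toC p))%:E)%E.

(* [w] is only constrained on [0, +oo[. "Increasing" is read as nondecreasing,
   so that bounded majorants such as [min(t, 1)] are included. *)
Definition majorant (w : R -> R) : Prop :=
  [/\ {within `[0, +oo[, continuous w},
      forall t, 0 <= t -> 0 <= w t,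
      forall s t, 0 <= s -> s <= t -> w s <= w t,
      w 0 = 0 &
      forall s t, 0 < s -> s <= t -> w t / t <= w s / s].

End Plane.

(* Main.v *)
Require Import Defs.
From HB Require Import structures.
From mathcomp Require Import all_boot all_order all_algebra.
From mathcomp Require Import all_classical all_reals all_analysis.
From mathcomp Require Import measurable_realfun complex ring lra.

Import Order.TTheory GRing.Theory Num.Theory.
Import numFieldNormedType.Exports.

Local Open Scope classical_set_scope.
Local Open Scope complex_scope.
Local Open Scope ring_scope.

(* Write P = (X, Y) for the position relative to the centre c of a disk D of
   radius r.

   From (ii) to (i): for a harmonic u on a neighbourhood of D and a linear form
   l(P), the function F(t) = int_D u(c + tP) l(P) satisfies t F'(t) = F(t), by
   the divergence theorem; hence F(1) = F'(0), which expresses the derivative of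
   u at c along l as a multiple of int_D (u - u(c)) l, since l has mean zero.
   Thus |grad u(c)| is at most 4/r times the mean of |u - u(c)| on D, and
   w(3/d) <= 3 w(1/d) absorbs the choice r = d/3.

   From (i) to (ii): on D, d(zeta) >= r - |P| gives Lambda_f(zeta) <=
   M w(1/r) r/(r - |P|), so integrating along rays bounds |f - f(c)| by a
   constant times r w(1/r) (1 - |P|/r)^(-1/2), and int_D r/sqrt(r^2 - |P|^2) <=
   3 |D| by the divergence theorem again.

   The divergence theorem is only needed as an inequality for one partial
   derivative on a disk, where it is Fubini's theorem together with the
   fundamental theorem of calculus on each chord; no polar coordinates occur. *)

Local Notation plane R := (measurableTypeR R * measurableTypeR R)%type.
Local Notation mu R := (@lebesgue_measure R).
Local Notation mu2 R := (@lebesgue_measure R \x @lebesgue_measure R)%E.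

(** * Euclidean disks in the plane: topology, measurability, integrability *)

Section PlaneDisks.
Set Implicit Arguments.
Unset Strict Implicit.
Variable R : realType.
Implicit Types (c p : R * R) (r : R) (u : R * R -> R).

(** The norm of [R * R] is the max norm, so Euclidean disks are described by this polynomial, which
    also keeps roots out of the differentiations. *)
Definition sqdist c p : R := (p.1 - c.1) ^+ 2 + (p.2 - c.2) ^+ 2.
Definition odisk c r : set (plane R) := [set p | sqdist c p < r ^+ 2].
Definition cdisk c r : set (plane R) := [set p | sqdist c p <= r ^+ 2].

(** The measurable sets of the plane are generated by products; an open set is the union of the
    rational open boxes that it contains, a countable family. *)
Lemma open_measurable_plane (U : set (R * R)) :
  open U -> measurable (U : set (plane R)).
Proof.
move=> oU.
pose box (q : (rat * rat) * (rat * rat)) : set (plane R) :=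
  `]ratr q.1.1, ratr q.1.2[ `*` `]ratr q.2.1, ratr q.2.2[.
have -> : (U : set (plane R)) =
    \bigcup_(q in [set q | box q `<=` (U : set (plane R))]) box q.
  apply/seteqP; split => [[x y] Uxy|p [q] /= qU]; last exact: qU.
  have [[A B] [/= nA nB] AB] : nbhs (x, y) U by move: oU; rewrite openE; exact.
  have itv (z : R) (V : set R) : nbhs z V -> exists a b : rat,
      [/\ ratr a < z, z < ratr b & `](ratr a : R), ratr b[ `<=` V].
    move=> /nbhs_ballP[e /= e0 eV].
    have /rat_in_itvoo[a] : z - e < z by rewrite ltrBlDr ltrDl.
    have /rat_in_itvoo[b] : z < z + e by rewrite ltrDl.
    rewrite !in_itv/= => /andP[zb be] /andP[ea az].
    exists a, b; split => // t /=; rewrite in_itv/= => /andP[at_ tb].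
    by apply: eV; rewrite /ball/= ltr_distlC; apply/andP; split; lra.
  have [a1 [b1 [a1x xb1 AV]]] := itv x A nA.
  have [a2 [b2 [a2y yb2 BV]]] := itv y B nB.
  exists ((a1, b1), (a2, b2)).
    by move=> [s t] [/= /AV As /BV Bt]; exact: AB.
  by split; rewrite /= in_itv/=; apply/andP.
rewrite bigcup_mkcond; apply: countable_bigcupT_measurable.
  exact: countableP.
move=> q; case: ifPn => _ //.
by apply: measurableX; exact: measurable_itv.
Qed.

Lemma continuous_measurable_plane (U : set (R * R)) u :
  open U -> (forall p, U p -> {for p, continuous u}) ->
  measurable_fun (U : set (plane R)) (u : plane R -> R).
Proof.
move=> oU cu mU; apply: (measurability _ (RGenOpens.measurableE R)) => //.
move=> _ [_ [a [b ->] <-]].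
apply: open_measurable_plane.
rewrite openE => p [Up /= upab].
rewrite /interior; near=> q; split.
  by near: q; apply: open_nbhs_nbhs.
near: q.
apply: (cu p Up).
by apply: open_nbhs_nbhs; split => //; exact: interval_open.
Unshelve. all: by end_near. Qed.

Lemma continuous_pairl (y : R) : continuous (fun x : R => (x, y)).
Proof.
move=> x; refine (@cvg_pair _ _ _ (nbhs x) (nbhs x) (nbhs y) _ _ _ id (cst y) _ _).
  exact: cvg_id.
exact: cvg_cst.
Qed.

Lemma continuous_pairr (x : R) : continuous (fun y : R => (x, y)).
Proof.
move=> y; refine (@cvg_pair _ _ _ (nbhs y) (nbhs x) (nbhs y) _ _ _ (cst x) id _ _).
  exact: cvg_cst.
exact: cvg_id.
Qed.

Lemma continuous_sqdist c : continuous (sqdist c : R * R -> R).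
Proof.
move=> p; rewrite (_ : sqdist c = fun p =>
  (p.1 - c.1) * (p.1 - c.1) + (p.2 - c.2) * (p.2 - c.2)); last first.
  by apply/funext => q; rewrite /sqdist !expr2.
by do ![exact: cvg_fst | exact: cvg_snd | exact: cvg_cst
  | apply: cvgD | apply: cvgM | apply: cvgN].
Qed.

Lemma open_odisk c r : open (odisk c r : set (R * R)).
Proof.
rewrite (_ : odisk c r = (sqdist c : R * R -> R) @^-1` [set x | x < r ^+ 2]) //.
by apply: open_comp; [move=> p _; exact: continuous_sqdist|exact: open_lt].
Qed.

Lemma closed_cdisk c r : closed (cdisk c r : set (R * R)).
Proof.
rewrite (_ : cdisk c r = (sqdist c : R * R -> R) @^-1` [set x | x <= r ^+ 2]) //.
by apply: closed_comp; [move=> p _; exact: continuous_sqdist|exact: closed_le].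
Qed.

Lemma measurable_odisk c r : measurable (odisk c r).
Proof. by apply: open_measurable_plane; exact: open_odisk. Qed.

Lemma odiskW c r : odisk c r `<=` cdisk c r.
Proof. by move=> p /ltW. Qed.

Lemma cdisk_coord c r p : 0 <= r -> cdisk c r p ->
  `|p.1 - c.1| <= r /\ `|p.2 - c.2| <= r.
Proof.
rewrite /cdisk/= /sqdist => r0 h; rewrite -!(ler_sqr (normr_ge0 _)) ?nnegrE//.
rewrite !real_normK ?num_real//.
by split; apply: le_trans h; rewrite ?lerDl ?lerDr sqr_ge0.
Qed.

Lemma compact_cdisk c r : compact (cdisk c r : set (R * R)).
Proof.
rewrite (_ : cdisk c r = cdisk c `|r|); last first.
  by rewrite /cdisk real_normK ?num_real.
apply: (@subclosed_compact _ _
  (`[c.1 - `|r|, c.1 + `|r|] `*` `[c.2 - `|r|, c.2 + `|r|])).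
- exact: closed_cdisk.
- by apply: compact_setX; exact: segment_compact.
- move=> p /(cdisk_coord (normr_ge0 r))[].
  rewrite !ler_norml => /andP[? ?] /andP[? ?].
  by split; rewrite /= in_itv/=; apply/andP; split; lra.
Qed.

Lemma bounded_on_cdisk c r u : (forall p, cdisk c r p -> {for p, continuous u}) ->
  exists M, 0 <= M /\ forall p, cdisk c r p -> `|u p| <= M.
Proof.
move=> cu.
have /compact_bounded : compact (u @` (cdisk c r : set (R * R))).
  apply: continuous_compact; last exact: compact_cdisk.
  by apply: continuous_in_subspaceT => p /set_mem; exact: cu.
(* Every number strictly above [M] is a bound, hence [M + 1]; the maximum with 0 supplies
   nonnegativity. *)
move=> [M [_ HM]]; exists (Num.max 0 (M + 1)); split.
  by rewrite le_max lexx.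
move=> p Hp; apply: (le_trans (HM (M + 1) _ _ _)).
- by rewrite ltrDl.
- by exists p.
- by rewrite le_max lexx orbT.
Qed.

Lemma mu2_odisk_lty c r : (mu2 R (odisk c r) < +oo)%E.
Proof.
pose A := (`[c.1 - `|r|, c.1 + `|r|] `*` `[c.2 - `|r|, c.2 + `|r|]
            : set (plane R)).
have mA : measurable A by apply: measurableX; exact: measurable_itv.
have : (mu2 R A < +oo)%E.
  rewrite product_measure1E; [|exact: measurable_itv|exact: measurable_itv].
  by rewrite /= !lebesgue_measure_itv/=; case: ifPn => _; case: ifPn => _;
    rewrite ?mule0 ?mul0e ?ltry// -!EFinD -EFinM ltry.
apply: le_lt_trans; apply: le_measure; rewrite ?inE//; first exact: measurable_odisk.
move=> p /odiskW; rewrite /cdisk /= -(@real_normK _ r) ?num_real// => H.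
have [] := cdisk_coord (normr_ge0 r) H.
rewrite !ler_norml => /andP[? ?] /andP[? ?].
by split; rewrite /= in_itv/=; apply/andP; split; lra.
Qed.

Lemma mu2_odisk_gt0 c r : 0 < r -> (0 < mu2 R (odisk c r))%E.
Proof.
move=> r0.
(* This square lies in the disk: its corners are at squared distance r^2 / 2 from the centre. *)
pose A := (`[c.1 - r / 2, c.1 + r / 2] `*` `[c.2 - r / 2, c.2 + r / 2]
            : set (plane R)).
have mA : measurable A by apply: measurableX; exact: measurable_itv.
have : (0 < mu2 R A)%E.
  rewrite product_measure1E; [|exact: measurable_itv|exact: measurable_itv].
  rewrite /= !lebesgue_measure_itv/= !lte_fin.
  rewrite !ifT; [|lra|lra].
  by rewrite -!EFinD -EFinM lte_fin mulr_gt0//; lra.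
move/lt_le_trans; apply; apply: le_measure; rewrite ?inE//.
  exact: measurable_odisk.
move=> [x y] [/=]; rewrite !in_itv/= => /andP[a b] /andP[d e].
by rewrite /odisk /sqdist/=; nra.
Qed.

(** Compactness of the closed disk bounds [u], and the disk has finite measure. *)
Lemma odisk_integrable c r u :
  (forall p, cdisk c r p -> {for p, continuous u}) ->
  (mu2 R).-integrable (odisk c r) (fun p => (u p)%:E).
Proof.
move=> cu; have [M [M0 HM]] := bounded_on_cdisk cu.
apply: measurable_bounded_integrable.
- exact: measurable_odisk.
- exact: mu2_odisk_lty.
- apply: continuous_measurable_plane; first exact: open_odisk.
  by move=> p /odiskW; exact: cu.
- exists M; split; first exact: num_real.
  by move=> x Mx p /odiskW Dp; apply: (le_trans (HM _ Dp)); exact: ltW.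
Qed.

End PlaneDisks.

(** * The divergence inequality on a disk, one coordinate at a time *)

Section DiskDivergence.
Variable R : realType.
Set Implicit Arguments.
Unset Strict Implicit.

(** The positive part of [f] vanishes on [D]. *)
Lemma integral_le0 d (T : measurableType d) (m : {measure set T -> \bar R})
    (D : set T) (f : T -> \bar R) :
  (forall x, D x -> (f x <= 0)%E) -> (\int[m]_(x in D) f x <= 0)%E.
Proof.
move=> f0; rewrite integralE (_ : (\int[m]_(x in D) f^\+ x = 0)%E).
  by rewrite sub0e oppe_le0 integral_ge0.
by apply: integral0_eq => x Dx; rewrite funeposE; apply/max_idPr; exact: f0.
Qed.

(** One chord, [s] being the square of its half-length: the integral of [F'] is the difference of
    the values of [F] at the two ends. For [s <= 0] the line misses the open disk, so the data are
    only asked for [0 < s]. *)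
Lemma slice_integral_le0 (F F' : R -> R) (a s : R) :
  (0 < s -> [/\ forall x, (x - a) ^+ 2 <= s -> is_derive x (1 : R) F (F' x),
      forall x, (x - a) ^+ 2 <= s -> {for x, continuous F'} &
      F (a + Num.sqrt s) <= F (a - Num.sqrt s)]) ->
  (\int[mu R]_x (((fun x => (F' x)%:E) \_ [set x | ((x - a) ^+ 2 < s)%R]) x) <= 0)%E.
Proof.
have [s0 /(_ isT)[dF cF' Fle]|s0 _] := ltP 0 s; last first.
  rewrite (_ : [set x | _] = set0) ?patch_set0 ?integral0//.
  apply/seteqP; split => // x /= h.
  by have := sqr_ge0 (x - a); rewrite leNgt (lt_le_trans h).
rewrite -integral_mkcond; set b := Num.sqrt s in Fle *.
have b0 : 0 < b by rewrite sqrtr_gt0.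
have bs : b ^+ 2 = s by rewrite sqr_sqrtr// ltW.
have inI x : x \in `[a - b, a + b] -> (x - a) ^+ 2 <= s.
  by rewrite in_itv/= => /andP[? ?]; rewrite -bs; nra.
have -> : [set x | (x - a) ^+ 2 < s] = `]a - b, a + b[%classic.
  apply/seteqP; split => x /=; rewrite in_itv/= -bs.
    by move=> h; apply/andP; split; nra.
  by move=> /andP[? ?]; nra.
have cc : {within `[a - b, a + b], continuous F'}.
  by apply: continuous_in_subspaceT => x /set_mem/= /inI; exact: cF'.
have cF x : (x - a) ^+ 2 <= s -> {for x, continuous F}.
  by move=> /dF [dx _]; apply: differentiable_continuous; exact/derivable1_diffP.
(* The fundamental theorem of calculus works on the closed interval; the end points form a null
   set. *)
rewrite -(@integral_itv_bndoo _ _ _ _ true false); last first.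
  apply/measurable_EFinP; apply: open_continuous_measurable_fun.
    exact: interval_open.
  by move=> x /set_mem/= /subset_itv_oo_cc/inI; exact: cF'.
rewrite (@continuous_FTC2 _ F' F); first by rewrite -EFinB lee_fin subr_le0.
- by lra.
- exact: cc.
- split.
  + by move=> x /subset_itv_oo_cc/inI /dF[].
  + apply: cvg_at_right_filter; apply: cF; rewrite -bs; nra.
  + apply: cvg_at_left_filter; apply: cF; rewrite -bs; nra.
- by move=> x /subset_itv_oo_cc/inI /dF h; rewrite derive1E derive_val.
Qed.

Variables (c : R * R) (r : R).
Variables A A' : R * R -> R.
Hypothesis cA' : forall p, cdisk c r p -> {for p, continuous A'}.

(** Fubini's theorem is applied on the whole plane, hence the extension by zero. *)
Let intA : (mu2 R).-integrable setT
  ((fun p => (A' p)%:E) \_ (odisk c r)).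
Proof.
apply: (integrable_mkcond (mu := mu2 R) (D := odisk c r) (fun p => (A' p)%:E) _).1.
  exact: measurable_odisk.
exact: odisk_integrable.
Qed.

(** Fubini's theorem slices the disk into horizontal chords, each handled by [slice_integral_le0].
    The boundary condition says that the field (A, 0) has no net outward flux through the two ends
    of a chord. *)
Lemma integral_dx_le0 :
  (forall p, cdisk c r p -> is_derive p.1 (1 : R) (fun x => A (x, p.2)) (A' p)) ->
  (forall y b, 0 <= b -> b ^+ 2 + (y - c.2) ^+ 2 = r ^+ 2 ->
    A (c.1 + b, y) <= A (c.1 - b, y)) ->
  (\int[mu2 R]_(p in odisk c r) (A' p)%:E <= 0)%E.
Proof.
move=> dA bA.
rewrite integral_mkcond -(integral21_prod_meas1 intA).
apply: integral_le0 => /=.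
move=> y _; rewrite /fubini_G.
under eq_integral.
  move=> x _; rewrite (_ : ((fun p => (A' p)%:E) \_ (odisk c r)) (x, y) =
    ((fun x => (A' (x, y))%:E) \_
      [set x | (x - c.1) ^+ 2 < r ^+ 2 - (y - c.2) ^+ 2]) x); last first.
    rewrite !patchE; congr (if _ then _ else _).
    by apply/idP/idP => /set_mem h; apply/mem_set; move: h;
      rewrite /odisk /sqdist /= ltrBrDr.
  over.
apply: (slice_integral_le0 (F := fun x => A (x, y))) => s0; split.
- move=> x; rewrite lerBrDr => Dxy; exact: (dA (x, y)).
- move=> x; rewrite lerBrDr => Dxy.
  apply: (@continuous_comp _ _ _ (fun x : R => (x, y)) A'); last exact: cA'.
  exact: continuous_pairl.
- by apply: bA; rewrite ?sqrtr_ge0// sqr_sqrtr ?subrK// ltW.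
Qed.

Lemma integral_dy_le0 :
  (forall p, cdisk c r p -> is_derive p.2 (1 : R) (fun y => A (p.1, y)) (A' p)) ->
  (forall x b, 0 <= b -> (x - c.1) ^+ 2 + b ^+ 2 = r ^+ 2 ->
    A (x, c.2 + b) <= A (x, c.2 - b)) ->
  (\int[mu2 R]_(p in odisk c r) (A' p)%:E <= 0)%E.
Proof.
move=> dA bA.
rewrite integral_mkcond -(integral12_prod_meas1 intA).
apply: integral_le0 => /=.
move=> x _; rewrite /fubini_F.
under eq_integral.
  move=> y _; rewrite (_ : ((fun p => (A' p)%:E) \_ (odisk c r)) (x, y) =
    ((fun y => (A' (x, y))%:E) \_
      [set y | (y - c.2) ^+ 2 < r ^+ 2 - (x - c.1) ^+ 2]) y); last first.
    rewrite !patchE; congr (if _ then _ else _).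
    by apply/idP/idP => /set_mem h; apply/mem_set; move: h;
      rewrite /odisk /sqdist /= ltrBrDr addrC.
  over.
apply: (slice_integral_le0 (F := fun y => A (x, y))) => s0; split.
- move=> y; rewrite lerBrDr addrC => Dxy; exact: (dA (x, y)).
- move=> y; rewrite lerBrDr addrC => Dxy.
  apply: (@continuous_comp _ _ _ (fun y : R => (x, y)) A'); last exact: cA'.
  exact: continuous_pairr.
- by apply: bA; rewrite ?sqrtr_ge0// sqr_sqrtr ?subrKC// ltW.
Qed.

End DiskDivergence.

(** * Partial derivatives as one-variable derivatives, and the chain rule along lines *)

Section PlaneCalculus.
Variable R : realType.
Set Implicit Arguments.
Unset Strict Implicit.
Implicit Types (c p : R * R) (r : R) (u : R * R -> R).

(** Both difference quotients are the same function of [h]. Directional derivatives thus become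
    derivatives on a line, open to the mean value theorem and the fundamental theorem of
    calculus. *)
Lemma is_derive_dx u p : derivable u p (ex R) ->
  is_derive p.1 (1 : R) (fun x => u (x, p.2)) ('D_(ex R) u p).
Proof.
move=> du.
have E : (fun h : R => h^-1 *: (((fun x => u (x, p.2)) \o shift p.1) (h *: 1) - u (p.1, p.2)))
  = (fun h => h^-1 *: ((u \o shift p) (h *: ex R) - u p)).
  apply/funext => h; rewrite /shift /= -surjective_pairing.
  congr (_ *: (u _ - u _)).
  rewrite [RHS](_ : _ = (h * 1 + p.1, h * 0 + p.2)) //.
  by rewrite mulr0 add0r.
by split; rewrite /derivable ?/derive E.
Qed.

Lemma is_derive_dy u p : derivable u p (ey R) ->
  is_derive p.2 (1 : R) (fun y => u (p.1, y)) ('D_(ey R) u p).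
Proof.
move=> du.
have E : (fun h : R => h^-1 *: (((fun y => u (p.1, y)) \o shift p.2) (h *: 1) - u (p.1, p.2)))
  = (fun h => h^-1 *: ((u \o shift p) (h *: ey R) - u p)).
  apply/funext => h; rewrite /shift /= -surjective_pairing.
  congr (_ *: (u _ - u _)).
  rewrite [RHS](_ : _ = (h * 0 + p.1, h * 1 + p.2)) //.
  by rewrite mulr0 add0r.
by split; rewrite /derivable ?/derive E.
Qed.

(** By the mean value theorem the left side is |g' x - m| |b - a| for some x between. Both orders of
    [a] and [b] occur, since increments may be negative. *)
Lemma mean_value_affine (g g' : R -> R) (a b m e : R) :
  (forall x, Num.min a b <= x <= Num.max a b ->
    is_derive x (1 : R) g (g' x) /\ `|g' x - m| <= e) ->
  `|g b - g a - m * (b - a)| <= e * `|b - a|.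
Proof.
wlog ab : a b / a <= b.
  move=> H; have [|ba] := orP (le_total a b); first exact: H.
  move=> h; have := H b a ba; rewrite [X in `|X|](_ : _ =
    - (g b - g a - m * (b - a))); last by ring.
  rewrite normrN (distrC a); apply => x; rewrite minC maxC; exact: h.
rewrite (min_idPl ab) (max_idPr ab) => h.
have [x xab ->] : exists2 x, x \in `[a, b] & g b - g a = g' x * (b - a).
  apply: (@MVT_segment _ g g') => //.
    by move=> x /subset_itv_oo_cc; rewrite in_itv/= => /h[].
  apply: derivable_within_continuous => x; rewrite in_itv/= => /h[dx _].
  exact: ex_derive.
rewrite -mulrBl normrM ler_wpM2r//.
by move: xab; rewrite in_itv/= => /h[].
Qed.

(** Continuous partial derivatives give differentiability: the increment splits into a vertical and
    a horizontal step, and [mean_value_affine] compares each with the partial derivative at [p]. *)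
Lemma is_derive_line u ux uy (U : set (R * R)) p (X Y : R) :
  open U ->
  (forall p, U p -> is_derive p.1 (1 : R) (fun x => u (x, p.2)) (ux p)) ->
  (forall p, U p -> is_derive p.2 (1 : R) (fun y => u (p.1, y)) (uy p)) ->
  {for p, continuous ux} -> {for p, continuous uy} -> U p ->
  is_derive (0 : R) (1 : R) (fun s : R => u (p.1 + s * X, p.2 + s * Y))
    (X * ux p + Y * uy p).
Proof.
move=> oU dx dy cx cy Up.
suff H : (fun h : R => h^-1 *: (((fun s : R => u (p.1 + s * X, p.2 + s * Y))
    \o shift 0) (h *: 1) - u (p.1 + 0 * X, p.2 + 0 * Y))) h @[h --> 0^']
    --> X * ux p + Y * uy p.
  by split; [apply/cvg_ex; exists (X * ux p + Y * uy p)|exact/cvg_lim].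
apply/cvgrPdist_le => e e0.
(* The two errors sum to at most k |h| (|X| + |Y|), hence to at most e |h|; the 1 keeps the
   denominator positive. *)
pose k := e / (`|X| + `|Y| + 1).
have k0 : 0 < k by rewrite divr_gt0// ltr_wpDl// addr_ge0.
have : \forall q \near p, [/\ U q, `|ux q - ux p| <= k & `|uy q - uy p| <= k].
  near=> q; split; near: q.
  - by apply: open_nbhs_nbhs.
  - by move/cvgrPdist_le : cx => /(_ _ k0); apply: filterS => q; rewrite distrC.
  - by move/cvgrPdist_le : cy => /(_ _ k0); apply: filterS => q; rewrite distrC.
move=> /nbhs_ballP[d /= d0 Hd].
have ballE q : `|q.1 - p.1| < d -> `|q.2 - p.2| < d ->
    [/\ U q, `|ux q - ux p| <= k & `|uy q - uy p| <= k].
  by move=> q1 q2; apply: Hd; split; rewrite /ball/= distrC.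
have W0 : 0 < `|X| + `|Y| + 1 by rewrite ltr_wpDl// addr_ge0.
near=> h.
have h0 : h != 0 by near: h; exact: nbhs_dnbhs_neq.
have hd : `|h| < d / (`|X| + `|Y| + 1).
  by near: h; apply: dnbhs0_lt; rewrite divr_gt0.
have hd' : `|h| * (`|X| + `|Y| + 1) < d by rewrite -ltr_pdivlMr.
have hX : `|h * X| < d by rewrite normrM; have := normr_ge0 Y; have := normr_ge0 h; nra.
have hY : `|h * Y| < d by rewrite normrM; have := normr_ge0 X; have := normr_ge0 h; nra.
have between (a b x : R) : Num.min a b <= x <= Num.max a b -> `|x - a| <= `|b - a|.
  case: (leP a b) => ab /andP[? ?]; first by rewrite !ger0_norm ?subr_ge0//; lra.
  by rewrite !ler0_norm ?subr_le0//; lra.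
have H1 : `|u (p.1 + h * X, p.2 + h * Y) - u (p.1, p.2 + h * Y)
          - ux p * (p.1 + h * X - p.1)| <= k * `|p.1 + h * X - p.1|.
  apply: (@mean_value_affine (fun x => u (x, p.2 + h * Y))
     (fun x => ux (x, p.2 + h * Y))) => x /between xb.
  have [] := ballE (x, p.2 + h * Y).
  - by apply: (le_lt_trans xb); rewrite addrAC subrr add0r.
  - by rewrite /= addrAC subrr add0r.
  - by move=> /dx ? ? _; split.
have H2 : `|u (p.1, p.2 + h * Y) - u (p.1, p.2)
          - uy p * (p.2 + h * Y - p.2)| <= k * `|p.2 + h * Y - p.2|.
  apply: (@mean_value_affine (fun y => u (p.1, y)) (fun y => uy (p.1, y))) => y /between yb.
  have [] := ballE (p.1, y).
  - by rewrite /= subrr normr0.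
  - by apply: (le_lt_trans yb); rewrite addrAC subrr add0r.
  - by move=> /dy ? _ ?; split.
move: H1 H2; rewrite !(addrAC _ (h * _)) !subrr !add0r => H1 H2.
rewrite /= !mul0r !addr0 [_ *: 1]mulr1.
rewrite -(ler_pM2l (_ : 0 < `|h|)) ?normr_gt0// -normrM mulrBr.
rewrite [h * (_ *: _)]mulrA divff// mul1r distrC.
have -> : u (p.1 + h * X, p.2 + h * Y) - u (p.1, p.2) - h * (X * ux p + Y * uy p)
  = (u (p.1 + h * X, p.2 + h * Y) - u (p.1, p.2 + h * Y) - ux p * (h * X))
  + (u (p.1, p.2 + h * Y) - u (p.1, p.2) - uy p * (h * Y)) by ring.
apply: (le_trans (ler_normD _ _)); apply: (le_trans (lerD H1 H2)).
rewrite !normrM -mulrDr -mulrDr mulrCA ler_wpM2l// /k.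
rewrite mulrAC ler_pdivrMr// ler_wpM2l ?ltW//.
lra.
Unshelve. all: by end_near. Qed.

Lemma is_derive_affine_comp (g : R -> R) (a t x d : R) :
  is_derive (a + t * (x - a)) (1 : R) g d ->
  is_derive x (1 : R) (fun x => g (a + t * (x - a))) (t * d).
Proof.
move=> dg.
have da : is_derive x (1 : R) (fun x : R => a + t * (x - a)) t.
  apply: is_derive_eq.
  by rewrite add0r mul1r subr0 [LHS]mulr1.
by rewrite mulrC; exact: (@is_derive1_comp _ g (fun x : R => a + t * (x - a))).
Qed.

(** Since q s = q t + (s - t) (p - c), this is [is_derive_line] at [q t] composed with a shift by
    [t]. *)
Lemma is_derive_ray u ux uy (U : set (R * R)) c p (t : R) :
  open U ->
  (forall p, U p -> is_derive p.1 (1 : R) (fun x => u (x, p.2)) (ux p)) ->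
  (forall p, U p -> is_derive p.2 (1 : R) (fun y => u (p.1, y)) (uy p)) ->
  (forall p, U p -> {for p, continuous ux}) ->
  (forall p, U p -> {for p, continuous uy}) ->
  let q s := (c.1 + s * (p.1 - c.1), c.2 + s * (p.2 - c.2)) in
  U (q t) ->
  is_derive t (1 : R) (fun s => u (q s))
    ((p.1 - c.1) * ux (q t) + (p.2 - c.2) * uy (q t)).
Proof.
move=> oU dx dy cx cy q Uq.
have := @is_derive_line u ux uy U (q t) (p.1 - c.1) (p.2 - c.2) oU dx dy
  (cx _ Uq) (cy _ Uq) Uq.
move=> H.
have -> : (fun s => u (q s)) = (fun s => u ((q t).1 + s * (p.1 - c.1),
    (q t).2 + s * (p.2 - c.2))) \o (fun s => s - t).
  by apply/funext => s /=; congr u; apply/pair_equal_spec; split; rewrite /q /=; ring.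
rewrite -[X in is_derive _ _ _ X]mulr1.
apply: is_derive1_comp; first by rewrite subrr.
by apply: is_derive_eq; rewrite subr0.
Qed.

End PlaneCalculus.

(** * The gradient of a harmonic function is controlled by its mean oscillation *)

Section GradientEstimate.
Variable R : realType.
Set Implicit Arguments.
Unset Strict Implicit.
Implicit Types (p : R * R) (f g : R * R -> R).

(** One component of the divergence in [eulerF]: [f] is the dilated function on a chord, [g] its
    derivative, [al * (x - a) + k] the linear form, and the first factor vanishes at the ends of the
    chord. The two terms in [al * g x] cancel. *)
Lemma is_derive_green (f g : R -> R) (a s al k x d : R) :
  is_derive x (1 : R) f (g x) -> is_derive x (1 : R) g d ->
  is_derive x (1 : R)
    (fun x => (s - (x - a) * (x - a)) / 2 * (al * f x - (al * (x - a) + k) * g x))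
    (- (x - a) * (al * f x - (al * (x - a) + k) * g x)
     - (s - (x - a) * (x - a)) / 2 * (al * (x - a) + k) * d).
Proof.
move=> df dg; apply: is_derive_eq; rewrite /GRing.scale /=.
by field.
Qed.

(* Euler's relation t g' = g makes g(t)/t constant on t > 0, with limit g'(0). *)
Lemma euler_homogeneous (g d : R -> R) :
  (forall t : R, -2 < t -> t < 2 -> is_derive t (1 : R) g (d t)) ->
  (forall t : R, -2 < t -> t < 2 -> g t = t * d t) -> g 1 = d 0.
Proof.
move=> dg gE; have lt20 : -2 < 0 :> R by lra.
have g0 : g 0 = 0 by rewrite gE ?mul0r.
have G (x : R) : 0 < x -> x < 2 -> is_derive x (1 : R) (fun x => g x * x^-1) 0.
  move=> x0 x2; have x20 : -2 < x by lra.
  have dgx := dg x x20 x2.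
  have xN0 : x != 0 by rewrite gt_eqF.
  have dV : is_derive x (1 : R) (fun y : R => y^-1) (- x ^- 2 *: 1).
    by apply: is_deriveV.
  apply: is_derive_eq.
  by rewrite (gE x x20 x2) /GRing.scale /=; field.
have mono (a b : R) : 0 < a -> a < b -> b < 2 -> g a / a = g b / b.
  move=> a0 ab b2; have ab2 x : x \in `[a, b] -> 0 < x /\ x < 2.
    by rewrite in_itv/= => /andP[? ?]; split; lra.
  have [||x _] := @MVT_segment R (fun x => g x * x^-1) (cst 0) a b (ltW ab).
  - by move=> x /subset_itv_oo_cc /ab2 [? ?]; exact: G.
  - apply: derivable_within_continuous => x /ab2[x0 x2].
    by have [] := G x x0 x2.
  - by rewrite mul0r => /eqP; rewrite subr_eq0 => /eqP.
have gt (t : R) : 0 < t -> t < 2 -> g t / t = g 1.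
  move=> t0 t2; have [t1|t1|->] := ltgtP t 1; last by rewrite divr1.
    by rewrite (mono t 1) ?divr1//; lra.
  by rewrite -(mono 1 t) ?divr1//; lra.
have [dg0 <-] := dg 0 lt20 (ltr0n _ 2).
(* The derivative at 0 exists, so it may be computed from the right, where g t / t is the constant
   [g 1]. *)
rewrite /derive cvg_at_rightE//.
apply/esym/cvg_lim => //; apply: cvg_near_cst.
near=> t.
have t0 : 0 < t by near: t; exact: nbhs_right_gt.
have t2 : t < 2 by near: t; apply: nbhs_right_lt.
by rewrite /= addr0 [t *: 1]mulr1 g0 subr0 -(gt t t0 t2) [LHS]mulrC.
Unshelve. all: by end_near. Qed.

(** * Integrals over a disk and its first and second moments *)

Variables (c : R * R) (r : R).
Hypothesis r0 : 0 < r.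

Notation D := (odisk c r).
Notation J f := (\int[mu2 R]_(p in odisk c r) f p)%R.

Definition continuous_cdisk f := forall p, cdisk c r p -> {for p, continuous f}.

Let X p := p.1 - c.1.
Let Y p := p.2 - c.2.
(** [h] vanishes on the circle and has gradient - P, so a field with the factor [h] leaves no
    boundary term. *)
Let h p := (r ^+ 2 - sqdist c p) / 2.

Let intD f : continuous_cdisk f -> (mu2 R).-integrable D (EFin \o f).
Proof. exact: odisk_integrable. Qed.

Lemma continuous_cdiskD f g : continuous_cdisk f -> continuous_cdisk g ->
  continuous_cdisk (fun p => f p + g p).
Proof. by move=> cf cg p Dp; apply: cvgD; [exact: cf|exact: cg]. Qed.

Lemma continuous_cdiskM f g : continuous_cdisk f -> continuous_cdisk g ->
  continuous_cdisk (fun p => f p * g p).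
Proof. by move=> cf cg p Dp; apply: cvgM; [exact: cf|exact: cg]. Qed.

Lemma continuous_cdisk_cst (k : R) : continuous_cdisk (fun=> k).
Proof. by move=> p _; exact: cvg_cst. Qed.

Let cN f : continuous_cdisk f -> continuous_cdisk (fun p => - f p).
Proof. by move=> cf p Dp; apply: cvgN; exact: cf. Qed.

Let cX : continuous_cdisk X.
Proof. by move=> p _; apply: cvgB; [exact: cvg_fst|exact: cvg_cst]. Qed.

Let cY : continuous_cdisk Y.
Proof. by move=> p _; apply: cvgB; [exact: cvg_snd|exact: cvg_cst]. Qed.

Let ch : continuous_cdisk h.
Proof.
apply: continuous_cdiskM; last exact: continuous_cdisk_cst.
apply: continuous_cdiskD; first exact: continuous_cdisk_cst.
by apply: cN => p _; exact: continuous_sqdist.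
Qed.

Ltac cont := repeat match goal with |- continuous_cdisk ?F =>
  match F with
  | (fun z => @Algebra.add _ (@?f z) (@?g z)) => apply: (@continuous_cdiskD f g)
  | (fun z => @GRing.mul _ (@?f z) (@?g z)) => apply: (@continuous_cdiskM f g)
  | (fun z => @Algebra.opp _ (@?f z)) => apply: (@cN f)
  | (fun z => X z) => exact: cX
  | (fun z => Y z) => exact: cY
  | (fun z => h z) => exact: ch
  | X => exact: cX
  | Y => exact: cY
  | h => exact: ch
  | (fun _ => ?k) => exact: continuous_cdisk_cst
  | _ => first [assumption | exact: continuous_cdisk_cst]
  end end.

Let JD f g : continuous_cdisk f -> continuous_cdisk g ->
  J (fun p => f p + g p) = J f + J g.
Proof.
by move=> cf cg; apply: RintegralD; [exact: measurable_odisk|exact: intD|exact: intD].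
Qed.

Let JZ k f : continuous_cdisk f -> J (fun p => k * f p) = k * J f.
Proof. by move=> cf; apply: RintegralZl; [exact: measurable_odisk|exact: intD]. Qed.

Let J0 f : continuous_cdisk f -> (\int[mu2 R]_(p in D) (f p)%:E <= 0)%E -> J f <= 0.
Proof.
move=> cf; rewrite -lee_fin /Rintegral fineK//.
by apply: integrable_fin_num; [exact: measurable_odisk|exact: intD].
Qed.

(** The divergence inequality holds for [A] and for [-1 * A], both zero on the circle. *)
Lemma Rintegral_dx_eq0 A A' : continuous_cdisk A' ->
  (forall p, cdisk c r p -> is_derive p.1 (1 : R) (fun x => A (x, p.2)) (A' p)) ->
  (forall p, sqdist c p = r ^+ 2 -> A p = 0) -> J A' = 0.
Proof.
move=> cA' dA bA; apply/eqP; rewrite eq_le; apply/andP; split.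
  apply: J0 => //; apply: (integral_dx_le0 (A := A)) => // y b _ e.
  by rewrite !bA// /sqdist /= -e; ring.
rewrite -oppr_le0 -mulN1r -JZ//; apply: J0; first by cont.
apply: (integral_dx_le0 (A := fun p => -1 * A p)).
- by apply: continuous_cdiskM => //; exact: continuous_cdisk_cst.
- move=> p /dA dAp /=; apply: is_derive_eq; by rewrite /GRing.scale/=; ring.
- by move=> y b _ e; rewrite !bA// /sqdist /= -e; ring.
Qed.

Lemma Rintegral_dy_eq0 A A' : continuous_cdisk A' ->
  (forall p, cdisk c r p -> is_derive p.2 (1 : R) (fun y => A (p.1, y)) (A' p)) ->
  (forall p, sqdist c p = r ^+ 2 -> A p = 0) -> J A' = 0.
Proof.
move=> cA' dA bA; apply/eqP; rewrite eq_le; apply/andP; split.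
  apply: J0 => //; apply: (integral_dy_le0 (A := A)) => // x b _ e.
  by rewrite !bA// /sqdist /= -e; ring.
rewrite -oppr_le0 -mulN1r -JZ//; apply: J0; first by cont.
apply: (integral_dy_le0 (A := fun p => -1 * A p)).
- by apply: continuous_cdiskM => //; exact: continuous_cdisk_cst.
- move=> p /dA dAp /=; apply: is_derive_eq; by rewrite /GRing.scale/=; ring.
- by move=> x b _ e; rewrite !bA// /sqdist /= -e; ring.
Qed.

Let h_eq0 p : sqdist c p = r ^+ 2 -> h p = 0.
Proof. by rewrite /h => ->; rewrite subrr mul0r. Qed.

Let hE p : h p = (r * r - X p * X p - Y p * Y p) / 2.
Proof. by rewrite /h /sqdist /X /Y; field. Qed.

Ltac dpoly := move=> p _ /=; apply: is_derive_eq; rewrite /GRing.scale/=; by field.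

(** The x-derivative of [h] is - X. *)
Let JX0 : J X = 0.
Proof.
have : J (fun p => -1 * X p) = 0.
  apply: (@Rintegral_dx_eq0 (fun p => (r * r - X p * X p - Y p * Y p) / 2)
    (fun p => -1 * X p)).
  - by cont.
  - by rewrite /X /Y; dpoly.
  - by move=> p /h_eq0; rewrite hE.
by rewrite JZ// => /eqP; rewrite mulf_eq0 oppr_eq0 oner_eq0 => /eqP.
Qed.

Let JY0 : J Y = 0.
Proof.
have : J (fun p => -1 * Y p) = 0.
  apply: (@Rintegral_dy_eq0 (fun p => (r * r - X p * X p - Y p * Y p) / 2)
    (fun p => -1 * Y p)).
  - by cont.
  - by rewrite /X /Y; dpoly.
  - by move=> p /h_eq0; rewrite hE.
by rewrite JZ// => /eqP; rewrite mulf_eq0 oppr_eq0 oner_eq0 => /eqP.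
Qed.

Let JXY : J (fun p => X p * Y p) = 0.
Proof.
have : J (fun p => -1 * (X p * Y p)) = 0.
  apply: (@Rintegral_dx_eq0 (fun p => (r * r - X p * X p - Y p * Y p) / 2 * Y p)
    (fun p => -1 * (X p * Y p))).
  - by cont.
  - by rewrite /X /Y; dpoly.
  - by move=> p /h_eq0 /=; rewrite hE => ->; rewrite mul0r.
by rewrite (@JZ _ (fun p => X p * Y p)); [move=> /eqP; rewrite mulf_eq0 oppr_eq0 oner_eq0 => /eqP|cont].
Qed.

(** The x-derivative of h X is h - X^2. *)
Let JXX : J (fun p => X p * X p) = J h.
Proof.
have : J (fun p => h p + -1 * (X p * X p)) = 0.
  apply: (@Rintegral_dx_eq0 (fun p => (r * r - X p * X p - Y p * Y p) / 2 * X p)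
    (fun p => h p + -1 * (X p * X p))).
  - by cont.
  - by rewrite /X /Y /h /sqdist; dpoly.
  - by move=> p /h_eq0 /=; rewrite hE => ->; rewrite mul0r.
rewrite (@JD h) ?(@JZ _ (fun p => X p * X p)); [by move=> ?; lra|by cont..].
Qed.

Let JYY : J (fun p => Y p * Y p) = J h.
Proof.
have : J (fun p => h p + -1 * (Y p * Y p)) = 0.
  apply: (@Rintegral_dy_eq0 (fun p => (r * r - X p * X p - Y p * Y p) / 2 * Y p)
    (fun p => h p + -1 * (Y p * Y p))).
  - by cont.
  - by rewrite /X /Y /h /sqdist; dpoly.
  - by move=> p /h_eq0 /=; rewrite hE => ->; rewrite mul0r.
rewrite (@JD h) ?(@JZ _ (fun p => Y p * Y p)); [by move=> ?; lra|by cont..].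
Qed.

(** In 2 h + X^2 + Y^2 = r^2 the left side integrates to four times [J h]. *)
Let Jh : J h = r ^+ 2 / 4 * J (fun=> 1).
Proof.
have : J (fun p => 2 * h p + (X p * X p + Y p * Y p)) = J (fun=> r ^+ 2 * 1).
  by apply: eq_Rintegral => p _; rewrite /h /sqdist /X /Y; field.
rewrite (@JD (fun p => 2 * h p)) ?(@JD (fun p => X p * X p)); [|by cont..].
rewrite (JZ _ ch) (@JZ _ (fun=> 1)) ?JXX ?JYY; last by cont.
by move=> ?; lra.
Qed.

(** The mixed moment vanishes and both square moments are r^2 / 4 times the area. Below, (a, b) is
    the gradient at the centre. *)
Lemma Rintegral_linear_product (al be a b : R) :
  J (fun p => (al * X p + be * Y p) * (X p * a + Y p * b))
  = r ^+ 2 / 4 * J (fun=> 1) * (al * a + be * b).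
Proof.
transitivity (J (fun p => al * a * (X p * X p)
   + (be * b * (Y p * Y p) + (al * b + be * a) * (X p * Y p)))).
  by apply: eq_Rintegral => p _; ring.
rewrite (@JD (fun p => al * a * (X p * X p))) ?(@JD (fun p => be * b * (Y p * Y p))); [|by cont..].
rewrite (@JZ _ (fun p => X p * X p)) ?(@JZ _ (fun p => Y p * Y p)) ?(@JZ _ (fun p => X p * Y p)); [|by cont..].
by rewrite JXX JYY JXY Jh; ring.
Qed.

(** * Euler's relation for the dilations of a harmonic function *)

Variables (U : set (R * R)) (u ux uy uxx uyy : R * R -> R) (al be : R).
Hypothesis oU : open U.
(** Room up to radius 2 r lets the dilation parameter range over ]-2, 2[, an open interval
    containing both 0 and 1. *)
Hypothesis DU : cdisk c (2 * r) `<=` (U : set (plane R)).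
Hypothesis dux : forall p, U p -> is_derive p.1 (1 : R) (fun x => u (x, p.2)) (ux p).
Hypothesis duy : forall p, U p -> is_derive p.2 (1 : R) (fun y => u (p.1, y)) (uy p).
Hypothesis duxx : forall p, U p -> is_derive p.1 (1 : R) (fun x => ux (x, p.2)) (uxx p).
Hypothesis duyy : forall p, U p -> is_derive p.2 (1 : R) (fun y => uy (p.1, y)) (uyy p).
Hypothesis cu : forall p, U p -> {for p, continuous u}.
Hypothesis cux : forall p, U p -> {for p, continuous ux}.
Hypothesis cuy : forall p, U p -> {for p, continuous uy}.
Hypothesis cuxx : forall p, U p -> {for p, continuous uxx}.
Hypothesis cuyy : forall p, U p -> {for p, continuous uyy}.
Hypothesis lap_u : forall p, U p -> uxx p + uyy p = 0.

Let q (t : R) p : R * R := (c.1 + t * X p, c.2 + t * Y p).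
Let l p := al * X p + be * Y p.
(** At t = 1 this integral involves [u] itself, while its derivative at t = 0 involves only the
    gradient at [c]. *)
Let F t := J (fun p => u (q t p) * l p).
Let F' t := J (fun p => l p * (X p * ux (q t p) + Y p * uy (q t p))).

Let q_cdisk (t : R) p : -2 < t -> t < 2 -> cdisk c r p -> cdisk c (2 * r) (q t p).
Proof.
move=> t1 t2; rewrite /cdisk /= (_ : sqdist c (q t p) = t ^+ 2 * sqdist c p).
  by move=> Dp; rewrite exprMn ler_pM ?sqr_ge0 ?addr_ge0 ?sqr_ge0//; nra.
by rewrite /sqdist /q /X /Y /=; ring.
Qed.

Let qU (t : R) p : -2 < t -> t < 2 -> cdisk c r p -> U (q t p).
Proof. by move=> t1 t2 Dp; apply: DU; exact: q_cdisk. Qed.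

Let cq (t : R) g : -2 < t -> t < 2 -> (forall p, U p -> {for p, continuous g}) ->
  continuous_cdisk (fun p => g (q t p)).
Proof.
move=> t1 t2 cg p Dp.
apply: (@continuous_comp _ _ _ (q t) g); last by apply: cg; exact: qU.
refine (@cvg_pair _ _ _ (nbhs p) (nbhs _) (nbhs _) _ _ _ _ _ _ _).
  by apply: cvgD; [exact: cvg_cst|apply: cvgM; [exact: cvg_cst|exact: cX]].
by apply: cvgD; [exact: cvg_cst|apply: cvgM; [exact: cvg_cst|exact: cY]].
Qed.

Let cl : continuous_cdisk l.
Proof. by rewrite /l; cont. Qed.

(** Differentiation under the integral sign: the partial derivatives of [u] are bounded on the
    doubled disk, so a constant [G] dominates uniformly in the parameter. *)
Let dF (t : R) : -2 < t -> t < 2 -> is_derive t (1 : R) F (F' t).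
Proof.
move=> t1 t2.
have [M1 [M10 HM1]] := bounded_on_cdisk (c := c) (r := 2 * r) (fun p Dp => cux (DU Dp)).
have [M2 [M20 HM2]] := bounded_on_cdisk (c := c) (r := 2 * r) (fun p Dp => cuy (DU Dp)).
have [L [L0 HL]] := bounded_on_cdisk cl.
pose f t p := u (q t p) * l p.
pose G p : R := L * (r * M1 + r * M2).
have It : `]-2, 2[%classic t by rewrite /= in_itv/= t1 t2.
have intf (s : R) : `]-2, 2[%classic s -> (mu2 R).-integrable D (EFin \o f s).
  rewrite /= in_itv/= => /andP[s1 s2]; apply: intD.
  by apply: continuous_cdiskM => //; exact: cq.
have df (s : R) p : `]-2, 2[%classic s -> D p ->
    is_derive s (1 : R) (f ^~ p) (l p * (X p * ux (q s p) + Y p * uy (q s p))).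
  rewrite /= in_itv/= => /andP[s1 s2] /odiskW Dp.
  have := is_derive_ray oU dux duy cux cuy (qU s1 s2 Dp).
  by move=> dV; apply: is_derive_eq; rewrite scaler0 add0r.
have derf (s : R) p : `]-2, 2[%classic s -> D p -> derivable (f ^~ p) s 1.
  by move=> Is Dp; have [] := df s p Is Dp.
have G0 p : 0 <= G p.
  by rewrite /G mulr_ge0// addr_ge0// mulr_ge0// ltW.
have intG : (mu2 R).-integrable D (EFin \o G).
  by apply: intD; exact: continuous_cdisk_cst.
have d1E (s : R) p : `]-2, 2[%classic s -> D p ->
    partial1of2 f s p = l p * (X p * ux (q s p) + Y p * uy (q s p)).
  by move=> Is Dp; rewrite partial1of2E; have [] := df s p Is Dp.
have GU (s : R) p : `]-2, 2[%classic s -> D p -> `|partial1of2 f s p| <= G p.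
  move=> Is Dp; rewrite (d1E _ _ Is Dp) normrM.
  move: Is; rewrite /= in_itv/= => /andP[s1 s2].
  have Dp' := odiskW Dp; have Dq := q_cdisk s1 s2 Dp'.
  have [Xr Yr] := cdisk_coord (ltW r0) Dp'.
  apply: ler_pM => //; first exact: HL.
  apply: (le_trans (ler_normD _ _)).
  by rewrite !normrM; apply: lerD; apply: ler_pM => //; [exact: HM1|exact: HM2].
split.
  exact: (derivable_under_integral (measurable_odisk c r) It intf derf G0 intG GU).
have := differentiation_under_integral (measurable_odisk c r) It intf derf G0 intG GU.
rewrite derive1E => ->.
by apply: eq_Rintegral => p /set_mem Dp; exact: d1E.
Qed.

Let eulerF (t : R) : -2 < t -> t < 2 -> F t = t * F' t.
Proof.
move=> t1 t2.
have cV := cq t1 t2 cu; have cVx := cq t1 t2 cux; have cVy := cq t1 t2 cuy.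
have cVxx := cq t1 t2 cuxx; have cVyy := cq t1 t2 cuyy.
(* The field (A, B) = h (u_t grad l - l grad u_t), where u_t(P) = u(c + tP) and
   h = (r^2 - |P|^2) / 2, vanishes on the circle; since u_t is harmonic its
   divergence is l P.grad u_t - l u_t. *)
pose A p := h p * (al * u (q t p) - l p * (t * ux (q t p))).
pose A' p := - X p * (al * u (q t p) - l p * (t * ux (q t p)))
  - h p * l p * (t * (t * uxx (q t p))).
pose B p := h p * (be * u (q t p) - l p * (t * uy (q t p))).
pose B' p := - Y p * (be * u (q t p) - l p * (t * uy (q t p)))
  - h p * l p * (t * (t * uyy (q t p))).
have cA' : continuous_cdisk A' by rewrite /A'; cont.
have cB' : continuous_cdisk B' by rewrite /B'; cont.
have JA : J A' = 0.
  apply: (@Rintegral_dx_eq0 A A' cA'); last first.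
    by move=> p /h_eq0 hp; rewrite /A hp mul0r.
  move=> p Dp; have Uq := qU t1 t2 Dp.
  have d1 := is_derive_affine_comp (dux Uq).
  have d2 := is_derive_affine_comp (duxx Uq).
  have d3 : is_derive p.1 (1 : R)
      (fun x => t * ux (c.1 + t * (x - c.1), (q t p).2)) (t * (t * uxx (q t p))).
    by apply: is_derive_eq.
  have := is_derive_green c.1 (r ^+ 2 - Y p * Y p) al (be * Y p) d1 d3.
  rewrite (_ : (fun x => A (x, p.2)) = (fun x =>
    (r ^+ 2 - Y p * Y p - (x - c.1) * (x - c.1)) / 2 *
    (al * u (c.1 + t * (x - c.1), (q t p).2) -
    (al * (x - c.1) + be * Y p) * (t * ux (c.1 + t * (x - c.1), (q t p).2))))).
    congr (is_derive _ _ _ _) => //; rewrite /A' /h /sqdist /l -/(q t p) /X /Y; by field.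
  by apply/funext => x; rewrite /A /h /sqdist /l /q /X /Y /=; field.
have JB : J B' = 0.
  apply: (@Rintegral_dy_eq0 B B' cB'); last first.
    by move=> p /h_eq0 hp; rewrite /B hp mul0r.
  move=> p Dp; have Uq := qU t1 t2 Dp.
  have d1 := is_derive_affine_comp (duy Uq).
  have d2 := is_derive_affine_comp (duyy Uq).
  have d3 : is_derive p.2 (1 : R)
      (fun y => t * uy ((q t p).1, c.2 + t * (y - c.2))) (t * (t * uyy (q t p))).
    by apply: is_derive_eq.
  have := is_derive_green c.2 (r ^+ 2 - X p * X p) be (al * X p) d1 d3.
  rewrite (_ : (fun y => B (p.1, y)) = (fun y =>
    (r ^+ 2 - X p * X p - (y - c.2) * (y - c.2)) / 2 *
    (be * u ((q t p).1, c.2 + t * (y - c.2)) -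
    (be * (y - c.2) + al * X p) * (t * uy ((q t p).1, c.2 + t * (y - c.2)))))).
    congr (is_derive _ _ _ _) => //; rewrite /B' /h /sqdist /l -/(q t p) /X /Y; by field.
  by apply/funext => y; rewrite /B /h /sqdist /l /q /X /Y /=; field.
have cdV : continuous_cdisk (fun p => l p * (X p * ux (q t p) + Y p * uy (q t p))).
  by cont.
(* Adding the two vanishing integrals makes the integrands agree pointwise; harmonicity, as uxx = -
   uyy, removes the terms in [h]. *)
transitivity (F t + J A' + J B'); first by rewrite JA JB !addr0.
rewrite /F /F' -JZ// -(@JD (fun p => u (q t p) * l p) A'); [|by cont..].
rewrite -(@JD (fun p => u (q t p) * l p + A' p) B'); [|by cont..].
apply: eq_Rintegral => p /set_mem /odiskW Dp.
have /eqP := lap_u (qU t1 t2 Dp); rewrite addr_eq0 => /eqP e.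
by rewrite /A' /B' e /l; ring.
Qed.

(** The left side is [F 1], Euler's relation gives F 1 = F' 0, and [Rintegral_linear_product]
    evaluates F' 0. *)
Lemma Rintegral_linear_gradient :
  J (fun p => u p * l p) = r ^+ 2 / 4 * J (fun=> 1) * (al * ux c + be * uy c).
Proof.
have q0 p : q 0 p = c by rewrite /q !mul0r !addr0 -surjective_pairing.
have q1 p : q 1 p = p by rewrite /q !mul1r !subrKC -surjective_pairing.
rewrite -Rintegral_linear_product.
transitivity (F 1); first by apply: eq_Rintegral => p _; rewrite q1.
transitivity (F' 0); last by apply: eq_Rintegral => p _; rewrite q0.
by apply: (@euler_homogeneous F F') => t t1 t2; [exact: dF|exact: eulerF].
Qed.

(** Since [l] has mean zero, [u] may be replaced by u - u c in [Rintegral_linear_gradient]. Then |l|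
    <= r bounds the integral, and one factor [r] cancels. *)
Lemma gradient_le_mean_oscillation :
  (forall p, cdisk c r p -> `|l p| <= r) ->
  `|al * ux c + be * uy c| * (r / 4 * J (fun=> 1)) <= J (fun p => `|u p - u c|).
Proof.
move=> lr.
have cu' : continuous_cdisk u.
  move=> p Dp; apply/cu/DU; apply: le_trans Dp _.
  by rewrite exprMn ler_peMl ?sqr_ge0//; lra.
have cuc : continuous_cdisk (fun p => u p - u c) by cont.
have ca : continuous_cdisk (fun p => `|u p - u c|).
  by move=> p Dp; apply: cvg_norm; exact: cuc.
have J1 : 0 <= J (fun=> 1) by apply: Rintegral_ge0.
have Jl : J l = 0.
  rewrite (@JD (fun p => al * X p)); [|by cont..].
  by rewrite !JZ// JX0 JY0 !mulr0 addr0.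
have E : r ^+ 2 / 4 * J (fun=> 1) * (al * ux c + be * uy c)
    = J (fun p => (u p - u c) * l p).
  rewrite -Rintegral_linear_gradient.
  transitivity (J (fun p => u p * l p) + J (fun p => - u c * l p)).
    by rewrite JZ// Jl mulr0 addr0.
  rewrite -(@JD (fun p => u p * l p)); [|by cont..].
  by apply: eq_Rintegral => p _; ring.
have cul : continuous_cdisk (fun p => (u p - u c) * l p) by cont.
have : `|J (fun p => (u p - u c) * l p)| <= r * J (fun p => `|u p - u c|).
  apply: (le_trans (le_normr_Rintegral (measurable_odisk c r) (intD cul))).
  rewrite -JZ//; apply: le_Rintegral; first exact: measurable_odisk.
  - by apply: intD => p Dp; apply: cvg_norm; exact: cul.
  - by apply: intD; apply: continuous_cdiskM => //; exact: continuous_cdisk_cst.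
  - move=> p /odiskW Dp; rewrite normrM mulrC.
    by rewrite ler_wpM2r//; exact: lr.
rewrite -E normrM ger0_norm; last by rewrite mulr_ge0// divr_ge0 ?sqr_ge0.
rewrite (_ : r ^+ 2 / 4 * _ * _ = r * (`|al * ux c + be * uy c| *
  (r / 4 * J (fun=> 1)))); last by ring.
by rewrite ler_pM2l.
Qed.

End GradientEstimate.

(** * The integral of r / sqrt(r^2 - |P|^2) over a disk *)

Section RadialGrowth.
Variable R : realType.
Set Implicit Arguments.
Unset Strict Implicit.
Implicit Types (c p : R * R) (r : R) (u : R * R -> R).

(** One component of the divergence of - P sqrt(r^2 - |P|^2); [s] absorbs the other coordinate. *)
Lemma is_derive_radial_sqrt (a s x : R) : 0 < s - (x - a) * (x - a) ->
  is_derive x (1 : R)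
    (fun x => - (x - a) * Num.sqrt (s - (x - a) * (x - a)))
    (- Num.sqrt (s - (x - a) * (x - a))
     + (x - a) * (x - a) / Num.sqrt (s - (x - a) * (x - a))).
Proof.
move=> w0.
have dw : is_derive x (1 : R) (fun x => s - (x - a) * (x - a)) (- 2 * (x - a)).
  by apply: is_derive_eq; rewrite /GRing.scale/=; ring.
have dS : is_derive x (1 : R) (fun x => Num.sqrt (s - (x - a) * (x - a)))
    ((2 * Num.sqrt (s - (x - a) * (x - a)))^-1 * (- 2 * (x - a))).
  exact: (@is_derive1_comp R Num.sqrt (fun x => s - (x - a) * (x - a))
    _ _ _ (is_derive1_sqrt w0) dw).
have sN0 : Num.sqrt (s - (x - a) * (x - a)) != 0 by rewrite gt_eqF// sqrtr_gt0.
by apply: is_derive_eq; rewrite /GRing.scale/=; field.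
Qed.

(** On a smaller disk the integrand is continuous up to the boundary. It is the divergence of an
    inward field, whose integral is at most 0, plus 3 sqrt(r^2 - |P|^2) / r, which is at most 3. *)
Lemma inv_sqrt_integral_lt c r rho : 0 <= rho -> rho < r ->
  (\int[mu2 R]_(p in odisk c rho) (r / Num.sqrt (r ^+ 2 - sqdist c p))%:E
   <= 3%:E * mu2 R (odisk c r))%E.
Proof.
move=> rho0 rhor; have r0 : 0 < r by exact: le_lt_trans rhor.
pose w p := r ^+ 2 - sqdist c p.
have w0 p : cdisk c rho p -> 0 < w p.
  by rewrite /cdisk /= /w subr_gt0 => /le_lt_trans; apply; nra.
have s0 p : cdisk c rho p -> 0 < Num.sqrt (w p).
  by move=> Dp; rewrite sqrtr_gt0 w0.
have cw p : {for p, continuous w}.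
  by apply: cvgB; [exact: cvg_cst|exact: continuous_sqdist].
have cs p : {for p, continuous (fun p => Num.sqrt (w p))}.
  by apply: (@continuous_comp _ _ _ w Num.sqrt) => //; exact: sqrt_continuous.
have cX p : {for p, continuous (fun p : R * R => p.1 - c.1)}.
  by apply: cvgB; [exact: cvg_fst|exact: cvg_cst].
have cY p : {for p, continuous (fun p : R * R => p.2 - c.2)}.
  by apply: cvgB; [exact: cvg_snd|exact: cvg_cst].
have cV p : cdisk c rho p -> {for p, continuous (fun p => (Num.sqrt (w p))^-1)}.
  by move=> Dp; apply: cvgV; [rewrite gt_eqF// s0|exact: cs].
(* With w = r^2 - |P|^2, the field - P sqrt w points inwards and has divergence
   r^2 / sqrt w - 3 sqrt w. *)
pose A' p := (- Num.sqrt (w p) + (p.1 - c.1) * (p.1 - c.1) / Num.sqrt (w p)) / r.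
pose B' p := (- Num.sqrt (w p) + (p.2 - c.2) * (p.2 - c.2) / Num.sqrt (w p)) / r.
pose C p := 3 * Num.sqrt (w p) / r.
have cA' p : cdisk c rho p -> {for p, continuous A'}.
  move=> Dp; apply: cvgM; last exact: cvg_cst.
  apply: cvgD; first by apply: cvgN; exact: cs.
  by apply: cvgM; [apply: cvgM; exact: cX|exact: cV].
have cB' p : cdisk c rho p -> {for p, continuous B'}.
  move=> Dp; apply: cvgM; last exact: cvg_cst.
  apply: cvgD; first by apply: cvgN; exact: cs.
  by apply: cvgM; [apply: cvgM; exact: cY|exact: cV].
have cC p : cdisk c rho p -> {for p, continuous C}.
  move=> Dp; apply: cvgM; last exact: cvg_cst.
  by apply: cvgM; [exact: cvg_cst|exact: cs].
have IA := odisk_integrable cA'; have IB := odisk_integrable cB'.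
have IC := odisk_integrable cC.
have mD := measurable_odisk c rho.
have JA : (\int[mu2 R]_(p in odisk c rho) (A' p)%:E <= 0)%E.
  apply: (integral_dx_le0 (A := fun p => - (p.1 - c.1) * Num.sqrt (w p) / r)) => //.
    move=> p Dp.
    have := @is_derive_radial_sqrt c.1 (r ^+ 2 - (p.2 - c.2) ^+ 2) p.1.
    rewrite (_ : r ^+ 2 - (p.2 - c.2) ^+ 2 - (p.1 - c.1) * (p.1 - c.1) = w p); last first.
      by rewrite /w /sqdist; ring.
    move=> /(_ (w0 p Dp)) H.
    rewrite [f in is_derive _ _ f](_ : _ = (fun x => (- (x - c.1) *
      Num.sqrt (r ^+ 2 - (p.2 - c.2) ^+ 2 - (x - c.1) * (x - c.1))) * r^-1)).
      by apply: is_derive_eq; rewrite scaler0 add0r [LHS]mulrC.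
    apply/funext => x; congr (_ * Num.sqrt _ * _).
    by rewrite /w /sqdist/=; ring.
  move=> y b b0 e.
  rewrite ler_pM2r ?invr_gt0// (_ : w (c.1 - b, y) = w (c.1 + b, y)); last first.
    by rewrite /w /sqdist/=; ring.
  by rewrite ler_wpM2r ?sqrtr_ge0//=; lra.
have JB : (\int[mu2 R]_(p in odisk c rho) (B' p)%:E <= 0)%E.
  apply: (integral_dy_le0 (A := fun p => - (p.2 - c.2) * Num.sqrt (w p) / r)) => //.
    move=> p Dp.
    have := @is_derive_radial_sqrt c.2 (r ^+ 2 - (p.1 - c.1) ^+ 2) p.2.
    rewrite (_ : r ^+ 2 - (p.1 - c.1) ^+ 2 - (p.2 - c.2) * (p.2 - c.2) = w p); last first.
      by rewrite /w /sqdist; ring.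
    move=> /(_ (w0 p Dp)) H.
    rewrite [f in is_derive _ _ f](_ : _ = (fun y => (- (y - c.2) *
      Num.sqrt (r ^+ 2 - (p.1 - c.1) ^+ 2 - (y - c.2) * (y - c.2))) * r^-1)).
      by apply: is_derive_eq; rewrite scaler0 add0r [LHS]mulrC.
    apply/funext => x; congr (_ * Num.sqrt _ * _).
    by rewrite /w /sqdist/=; ring.
  move=> x b b0 e.
  rewrite ler_pM2r ?invr_gt0// (_ : w (x, c.2 - b) = w (x, c.2 + b)); last first.
    by rewrite /w /sqdist/=; ring.
  by rewrite ler_wpM2r ?sqrtr_ge0//=; lra.
have -> : (\int[mu2 R]_(p in odisk c rho) (r / Num.sqrt (r ^+ 2 - sqdist c p))%:E
  = \int[mu2 R]_(p in odisk c rho) ((A' p)%:E + ((B' p)%:E + (C p)%:E)))%E.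
  apply: eq_integral => p /set_mem/odiskW Dp; rewrite -!EFinD; congr (_%:E).
  have := sqr_sqrtr (ltW (w0 p Dp)).
  rewrite -/(w p) {2}/w /sqdist /A' /B' /C => e.
  have sN0 : Num.sqrt (w p) != 0 by rewrite gt_eqF// s0.
  have rN0 : r != 0 by rewrite gt_eqF.
  (* Eliminating X^2 makes the identity rational in sqrt w. *)
  have -> : (p.1 - c.1) * (p.1 - c.1)
      = r ^+ 2 - (p.2 - c.2) * (p.2 - c.2) - Num.sqrt (w p) ^+ 2 by rewrite e; ring.
  by field; rewrite sN0 rN0.
rewrite (integralD mD IA) ?(integralD mD IB IC)//; last exact: integrableD.
apply: (@le_trans _ _ (0 + (0 + \int[mu2 R]_(p in odisk c rho) (C p)%:E))%E).
  by apply: leeD => //; apply: leeD.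
rewrite !add0e -(integral_cst _ (measurable_odisk c r)).
apply: (@le_trans _ _ (\int[mu2 R]_(p in odisk c rho) (cst 3%:E) p)%E).
  apply: ge0_le_integral => //.
  - move=> p _; rewrite lee_fin /C divr_ge0 ?mulr_ge0 ?sqrtr_ge0//; exact: ltW.
  - by case/integrableP : IC.
  - move=> p /odiskW Dp; rewrite lee_fin /C ler_pdivrMr// ler_pM2l//.
    rewrite -ler_sqr ?nnegrE ?sqrtr_ge0 ?(ltW r0)//.
    rewrite sqr_sqrtr; last by rewrite ltW// w0.
    by rewrite /w lerBlDr lerDl addr_ge0 ?sqr_ge0.
apply: ge0_subset_integral;
  [exact: mD|exact: measurable_odisk|exact: measurable_cst| |].
  by move=> p _; rewrite lee_fin.
by move=> p /=; rewrite /odisk /= => /lt_trans; apply; nra.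
Qed.

Lemma inv_sqrt_integral c r : 0 < r ->
  (\int[mu2 R]_(p in odisk c r) (r / Num.sqrt (r ^+ 2 - sqdist c p))%:E
   <= 3%:E * mu2 R (odisk c r))%E.
Proof.
move=> r0.
(* The integrand is unbounded near the circle: exhaust by smaller disks. *)
pose rho n : R := r * (1 - n.+1%:R^-1).
have i01 n : 0 < (n.+1%:R^-1 : R) <= 1.
  by rewrite invr_gt0 ltr0n /= invf_le1 ?ltr0n// ler1n.
have rho0 n : 0 <= rho n.
  by have /andP[? ?] := i01 n; rewrite /rho mulr_ge0 ?subr_ge0// ltW.
have rhor n : rho n < r.
  by have /andP[? ?] := i01 n; rewrite /rho gtr_pMr// ltrBlDr ltrDl.
have sq0 p : 0 <= sqdist c p by rewrite /sqdist addr_ge0 ?sqr_ge0.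
have DE : odisk c r = \bigcup_n odisk c (rho n).
  apply/seteqP; split => p; last first.
    move=> [n _]; rewrite /odisk /= => /lt_trans; apply.
    by have := rho0 n; have := rhor n; nra.
  rewrite /odisk /= => Dp.
  have sr : Num.sqrt (sqdist c p) < r.
    by rewrite -(ltr_sqr (sqrtr_ge0 _)) ?nnegrE ?(ltW r0)// sqr_sqrtr.
  have [|k hk] := @ltr_add_invr R (Num.sqrt (sqdist c p) / r) 1.
    by rewrite ltr_pdivrMr// mul1r.
  exists k => //=; rewrite -[ltLHS](sqr_sqrtr (sq0 p)).
  by rewrite ltr_sqr ?nnegrE ?sqrtr_ge0// /rho mulrC -ltr_pdivrMr// ltrBrDr.
rewrite DE.
have mf n : measurable_fun (odisk c (rho n))
    (fun p => (r / Num.sqrt (r ^+ 2 - sqdist c p))%:E).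
  have : (mu2 R).-integrable (odisk c (rho n))
     (fun p => (r / Num.sqrt (r ^+ 2 - sqdist c p))%:E).
    apply: odisk_integrable => p; rewrite /cdisk /= => Dp.
    apply: cvgM; first exact: cvg_cst.
    apply: cvgV.
      rewrite gt_eqF// sqrtr_gt0 subr_gt0 (le_lt_trans Dp)//.
      by have := rho0 n; have := rhor n; nra.
    apply: (@continuous_comp _ _ _ (fun p => r ^+ 2 - sqdist c p) Num.sqrt).
      by apply: cvgB; [exact: cvg_cst|exact: continuous_sqdist].
    exact: sqrt_continuous.
  by case/integrableP.
(* Monotone convergence along the increasing disks carries the uniform bound over to their union. *)
have cv : ((\int[mu2 R]_(p in odisk c (rho i)) (r / Num.sqrt (r ^+ 2 - sqdist c p))%:E)%E
   @[i --> \oo] --> (\int[mu2 R]_(p in \bigcup_i odisk c (rho i))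
     (r / Num.sqrt (r ^+ 2 - sqdist c p))%:E)%E).
  apply: ge0_nondecreasing_set_cvg_integral => //.
  - move=> n m nm; apply/subsetPset => p; rewrite /odisk /= => /lt_le_trans; apply.
    rewrite ler_sqr ?nnegrE// /rho ler_pM2l// lerD2l lerN2.
    by rewrite lef_pV2 ?posrE ?ltr0n// ler_nat.
  - by move=> i; exact: measurable_odisk.
  - by move=> i p _; rewrite lee_fin divr_ge0 ?sqrtr_ge0// ltW.
rewrite -(cvg_lim _ cv)//; apply: lime_le.
  by apply/cvg_ex; eexists; exact: cv.
by apply: nearW => n; rewrite -DE; exact: inv_sqrt_integral_lt.
Qed.

End RadialGrowth.

(** * From a gradient bound to growth along rays *)

Section RadialGrowthBound.
Variable R : realType.
Set Implicit Arguments.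
Unset Strict Implicit.

(* Comparison with phi(t) = 2 K (1 - t s)^(-1/2), whose derivative
   K s (1 - t s)^(-3/2) dominates the bound on g'. *)
Lemma growth_along_ray (g g' : R -> R) (K s : R) : 0 <= K -> 0 <= s -> s < 1 ->
  (forall t : R, 0 <= t -> t <= 1 ->
    is_derive t (1 : R) g (g' t) /\ `|g' t| <= K * s / (1 - t * s)) ->
  `|g 1 - g 0| <= 2 * K / Num.sqrt (1 - s).
Proof.
move=> K0 s0 s1 dg.
pose S (t : R) := Num.sqrt (1 - t * s).
pose phi (t : R) := 2 * K * (S t)^-1.
have w0 (t : R) : 0 <= t -> t <= 1 -> 0 < 1 - t * s by nra.
have S0 (t : R) : 0 <= t -> t <= 1 -> 0 < S t.
  by move=> t0 t1; rewrite sqrtr_gt0 w0.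
have SS (t : R) : 0 <= t -> t <= 1 -> S t ^+ 2 = 1 - t * s.
  by move=> t0 t1; rewrite sqr_sqrtr// ltW// w0.
have dphi (t : R) : 0 <= t -> t <= 1 ->
    is_derive t (1 : R) phi (K * s / (S t ^+ 2 * S t)).
  move=> t0 t1.
  have dw : is_derive t (1 : R) (fun t => 1 - t * s) (- s).
    by apply: is_derive_eq; rewrite /GRing.scale/=; ring.
  have dS : is_derive t (1 : R) S ((2 * S t)^-1 * (- s)).
    exact: (@is_derive1_comp R Num.sqrt (fun t => 1 - t * s)
      _ _ _ (is_derive1_sqrt (w0 t t0 t1)) dw).
  have sN0 : S t != 0 by rewrite gt_eqF// S0.
  have dV := is_deriveV sN0 dS.
  by apply: is_derive_eq; rewrite /GRing.scale/=; field.
(* The cases [e = 1] and [e = -1] give the absolute value. The function phi - e g has nonnegative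
   derivative, and phi 0 >= 0 is dropped. *)
have mono (e : R) : `|e| <= 1 -> e * (g 1 - g 0) <= phi 1.
  move=> e1.
  have dH (t : R) : 0 <= t -> t <= 1 -> is_derive t (1 : R)
      (fun t => phi t - e * g t) (K * s / (S t ^+ 2 * S t) - e * g' t).
    move=> t0 t1; have H1 := dphi t t0 t1; have [H2 _] := dg t t0 t1.
    by apply: is_derive_eq; rewrite /GRing.scale/=; ring.
  have [||t] := @MVT_segment R (fun t => phi t - e * g t)
    (fun t => K * s / (S t ^+ 2 * S t) - e * g' t) 0 1 ler01.
  - by move=> t; rewrite in_itv/= => /andP[/ltW ? /ltW ?]; exact: dH.
  - apply: derivable_within_continuous => t; rewrite in_itv/= => /andP[t0 t1].
    by have [] := dH t t0 t1.
  rewrite in_itv/= => /andP[t0 t1] E.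
  have phi0 : 0 <= phi 0 by rewrite /phi mulr_ge0 ?mulr_ge0// invr_ge0 ltW// S0.
  have : 0 <= K * s / (S t ^+ 2 * S t) - e * g' t.
    rewrite subr_ge0; apply: (le_trans (ler_norm _)); rewrite normrM.
    have [_ bg] := dg t t0 t1.
    apply: (@le_trans _ _ (1 * (K * s / (1 - t * s)))).
      by apply: ler_pM.
    (* As S t <= 1, the cube of S t is at most its square 1 - t s. *)
    rewrite mul1r -(SS t t0 t1) ler_wpM2l ?mulr_ge0//.
    rewrite lef_pV2 ?posrE ?mulr_gt0 ?exprn_gt0 ?S0//.
    rewrite ger_pMr ?exprn_gt0 ?S0//.
    rewrite -(ler_pXn2r (n := 2)) ?nnegrE ?(ltW (S0 t t0 t1))// SS// expr1n.
    by rewrite lerBlDr lerDl mulr_ge0.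
  by rewrite -subr_ge0 => h; lra.
have P1 : phi 1 = 2 * K / Num.sqrt (1 - s) by rewrite /phi /S mul1r.
rewrite -P1 ler_norml; apply/andP; split.
  by have := mono (-1); rewrite normrN normr1 lexx => /(_ isT); lra.
by have := mono 1; rewrite normr1 lexx => /(_ isT); lra.
Qed.

(** With d = |P| and s = d / r, the derivative of u along the ray is at most 2 K r s / (1 - t s), so
    [growth_along_ray] applies with constant 2 K r. The resulting inverse square root is what
    [inv_sqrt_integral] integrates. *)
Lemma radial_growth (c : R * R) (r K : R) (u ux uy : R * R -> R) :
  0 < r -> 0 <= K ->
  (forall p, odisk c r p -> is_derive p.1 (1 : R) (fun x => u (x, p.2)) (ux p)) ->
  (forall p, odisk c r p -> is_derive p.2 (1 : R) (fun y => u (p.1, y)) (uy p)) ->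
  (forall p, odisk c r p -> {for p, continuous ux}) ->
  (forall p, odisk c r p -> {for p, continuous uy}) ->
  (forall p, odisk c r p -> `|ux p| <= K * (r / (r - Num.sqrt (sqdist c p)))) ->
  (forall p, odisk c r p -> `|uy p| <= K * (r / (r - Num.sqrt (sqdist c p)))) ->
  forall p, odisk c r p ->
    `|u p - u c| <= 8 * K * r * (r / Num.sqrt (r ^+ 2 - sqdist c p)).
Proof.
move=> r0 K0 dux duy cux cuy bx by_ p Dp.
pose d := Num.sqrt (sqdist c p).
have sq0 q : 0 <= sqdist c q by rewrite /sqdist addr_ge0 ?sqr_ge0.
have d0 : 0 <= d by rewrite sqrtr_ge0.
have dd : d ^+ 2 = sqdist c p by rewrite sqr_sqrtr.
have dr : d < r by rewrite -ltr_sqr ?nnegrE ?(ltW r0)// dd.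
pose q (t : R) := (c.1 + t * (p.1 - c.1), c.2 + t * (p.2 - c.2)).
have sq t : sqdist c (q t) = (t * d) ^+ 2.
  by rewrite exprMn dd /sqdist /q /=; ring.
have Dq t : 0 <= t -> t <= 1 -> odisk c r (q t).
  by move=> t0 t1; rewrite /odisk /= sq ltr_sqr ?nnegrE ?mulr_ge0 ?(ltW r0)//; nra.
pose s := d / r.
have s0 : 0 <= s by rewrite divr_ge0// ltW.
have s1 : s < 1 by rewrite ltr_pdivrMr// mul1r.
have sr : s * r = d by rewrite /s divfK// gt_eqF.
have K20 : 0 <= 2 * K * r by rewrite mulr_ge0 ?mulr_ge0// ltW.
have [Xd Yd] : `|p.1 - c.1| <= d /\ `|p.2 - c.2| <= d.
  by apply: (@cdisk_coord R c d p) => //; rewrite /cdisk /= dd.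
have H : `|u (q 1) - u (q 0)| <= 2 * (2 * K * r) / Num.sqrt (1 - s).
  apply: (@growth_along_ray (fun t => u (q t))
    (fun t => (p.1 - c.1) * ux (q t) + (p.2 - c.2) * uy (q t))) => // t t0 t1.
  split; first exact: (@is_derive_ray R u ux uy (odisk c r) c p t
    (@open_odisk R c r) dux duy cux cuy (Dq t t0 t1)).
  apply: (le_trans (ler_normD _ _)); rewrite !normrM.
  have w : Num.sqrt (sqdist c (q t)) = t * d.
    by rewrite sq sqrtr_sqr ger0_norm// mulr_ge0.
  have := bx _ (Dq t t0 t1); have := by_ _ (Dq t t0 t1).
  rewrite w => b2 b1.
  apply: (@le_trans _ _ (d * (K * (r / (r - t * d))) + d * (K * (r / (r - t * d))))).
    by apply: lerD; apply: ler_pM.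
  rewrite le_eqVlt; apply/orP; left; apply/eqP.
  have e : r - t * d = r * (1 - t * s) by rewrite -sr; ring.
  have n1 : 1 - t * s != 0 by rewrite gt_eqF//; nra.
  have n2 : r != 0 by rewrite gt_eqF.
  by rewrite e -sr; field; rewrite n1 n2.
move: H; rewrite /q !mul1r !subrKC !mul0r !addr0 -!surjective_pairing.
move=> /le_trans; apply.
have w1 : 0 < 1 - s by rewrite subr_gt0.
have w2 : 0 < r ^+ 2 - sqdist c p by rewrite subr_gt0.
(* From r^2 - d^2 = r^2 (1 - s) (1 + s) and 1 + s <= 4, the factor 1 / sqrt(1 - s) is at most 2 r /
   sqrt(r^2 - d^2); this turns 4 into 8. *)
have -> : 8 * K * r * (r / Num.sqrt (r ^+ 2 - sqdist c p)) =
    2 * (2 * K * r) * (2 * r / Num.sqrt (r ^+ 2 - sqdist c p)).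
  by rewrite !mulrA; congr (_ / _); ring.
rewrite ler_wpM2l ?mulr_ge0//; first exact: ltW.
rewrite ler_pdivlMr ?sqrtr_gt0// mulrC ler_pdivrMr ?sqrtr_gt0//.
rewrite -ler_sqr ?nnegrE ?mulr_ge0 ?sqrtr_ge0 ?(ltW r0)//.
rewrite !exprMn !sqr_sqrtr ?(ltW w1) ?(ltW w2)// -dd -sr.
have : 0 <= r ^+ 2 * (1 - s) by rewrite mulr_ge0 ?sqr_ge0// ltW.
by nra.
Qed.

End RadialGrowthBound.

(** * Moduli, Wirtinger derivatives and real partial derivatives *)

Section ComplexGlue.
Variable R : realType.
Set Implicit Arguments.
Unset Strict Implicit.
Implicit Types (z : R[i]) (r : R) (f : R[i] -> R[i]).

Lemma cabsE z : cabs z = Num.sqrt (complex.Re z ^+ 2 + complex.Im z ^+ 2).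
Proof. by case: z. Qed.

Lemma normr_Re_le_cabs z : `|complex.Re z| <= cabs z.
Proof. by rewrite cabsE -sqrtr_sqr ler_wsqrtr// lerDl sqr_ge0. Qed.

Lemma normr_Im_le_cabs z : `|complex.Im z| <= cabs z.
Proof. by rewrite cabsE -sqrtr_sqr ler_wsqrtr// lerDr sqr_ge0. Qed.

Lemma cabs_le z : cabs z <= `|complex.Re z| + `|complex.Im z|.
Proof.
rewrite cabsE -(ler_sqr (x := Num.sqrt _)) ?nnegrE ?sqrtr_ge0 ?addr_ge0//.
rewrite sqr_sqrtr ?addr_ge0 ?sqr_ge0// -(real_normK (num_real (complex.Re z))).
rewrite -(real_normK (num_real (complex.Im z))).
by have := normr_ge0 (complex.Re z); have := normr_ge0 (complex.Im z); nra.
Qed.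

Lemma cabs_toC (p : R * R) z : cabs (toC p - z) = Num.sqrt (sqdist (ofC z) p).
Proof. by case: z => a b; rewrite cabsE. Qed.

Lemma preimage_disk z r : 0 < r -> @toC R @^-1` disk z r = odisk (ofC z) r.
Proof.
move=> r0; have sq0 p : 0 <= sqdist (ofC z) p by rewrite addr_ge0 ?sqr_ge0.
apply/funext => p; apply/propext; rewrite /disk /odisk /= cabs_toC.
by rewrite -[X in _ <-> is_true (X < _)]sqr_sqrtr// ltr_sqr ?nnegrE ?sqrtr_ge0 ?ltW.
Qed.

Lemma Re_half z : complex.Re (z / 2) = complex.Re z / 2.
Proof.
have -> : (2 : R[i])^-1 = (2^-1 : R)%:C by rewrite fmorphV rmorph_nat.
by case: z => a b /=; ring.
Qed.

Lemma Im_half z : complex.Im (z / 2) = complex.Im z / 2.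
Proof.
have -> : (2 : R[i])^-1 = (2^-1 : R)%:C by rewrite fmorphV rmorph_nat.
by case: z => a b /=; ring.
Qed.

Lemma wirtinger_parts f z (ux := 'D_(ex R) (re_part f) (ofC z))
    (vx := 'D_(ex R) (im_part f) (ofC z)) (uy := 'D_(ey R) (re_part f) (ofC z))
    (vy := 'D_(ey R) (im_part f) (ofC z)) :
  [/\ complex.Re (wirtinger f z) = (ux + vy) / 2,
      complex.Im (wirtinger f z) = (vx - uy) / 2,
      complex.Re (wirtinger_bar f z) = (ux - vy) / 2 &
      complex.Im (wirtinger_bar f z) = (vx + uy) / 2].
Proof.
by rewrite !Re_half !Im_half /partial /=; split; congr (_ / 2);
  rewrite -/ux -/uy -/vx -/vy; ring.
Qed.

(** Each partial derivative is a sum or difference of the real parts, or of the imaginary parts, of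
    the two Wirtinger derivatives. *)
Lemma partials_le_Lambda f z :
  [/\ `|'D_(ex R) (re_part f) (ofC z)| <= Lambda f z,
      `|'D_(ey R) (re_part f) (ofC z)| <= Lambda f z,
      `|'D_(ex R) (im_part f) (ofC z)| <= Lambda f z &
      `|'D_(ey R) (im_part f) (ofC z)| <= Lambda f z].
Proof.
have [] := wirtinger_parts f z; rewrite /Lambda.
move: (wirtinger f z) (wirtinger_bar f z) => a b.
have := normr_Re_le_cabs a; have := normr_Im_le_cabs a.
have := normr_Re_le_cabs b; have := normr_Im_le_cabs b.
rewrite !ler_norml => /andP[? ?] /andP[? ?] /andP[? ?] /andP[? ?] ? ? ? ?.
by split; apply/andP; split; lra.
Qed.

(** Each partial derivative occurs in two of the four real and imaginary parts, with weight 1/2. *)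
Lemma Lambda_le_partials f z :
  Lambda f z <= `|'D_(ex R) (re_part f) (ofC z)| + `|'D_(ey R) (re_part f) (ofC z)|
    + `|'D_(ex R) (im_part f) (ofC z)| + `|'D_(ey R) (im_part f) (ofC z)|.
Proof.
have [] := wirtinger_parts f z; rewrite /Lambda.
move=> e1 e2 e3 e4.
have := cabs_le (wirtinger f z); have := cabs_le (wirtinger_bar f z).
rewrite e1 e2 e3 e4.
set a := 'D__ (re_part f) _; set b := 'D__ (re_part f) _.
set d := 'D__ (im_part f) _; set e := 'D__ (im_part f) _.
rewrite !normrM !(ger0_norm (_ : 0 <= 2^-1 :> R)) ?invr_ge0//.
have := ler_normD a d; have := ler_normB a d.
have := ler_normD e b; have := ler_normB e b.
by lra.
Qed.

End ComplexGlue.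

(** * Harmonic functions on the unit disk, and majorants *)

Section BlochGrowth.
Variable R : realType.
Set Implicit Arguments.
Unset Strict Implicit.
Implicit Types (z : R[i]) (r : R) (f : R[i] -> R[i]) (u : R * R -> R) (c p : R * R).

Notation U := (odisk (0, 0) 1 : set (R * R)).

Lemma cabs_ofC z : cabs z = Num.sqrt (sqdist (0, 0) (ofC z)).
Proof. by rewrite cabsE /sqdist /= !subr0. Qed.

Lemma preimage_unit_disk : @toC R @^-1` @unit_disk R = U.
Proof.
apply/funext => p; apply/propext; have -> : (@toC R @^-1` @unit_disk R) p = (cabs (toC p) < 1) by [].
by rewrite cabs_ofC /odisk /mkset -[X in _ < X](sqrtr1 R) ltr_sqrt ?expr1n.
Qed.

Lemma sqrt_sqdist_triangle c p : Num.sqrt (sqdist (0, 0) p) <=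
  Num.sqrt (sqdist (0, 0) c) + Num.sqrt (sqdist c p).
Proof.
case: c p => [a b] [x y]; rewrite /sqdist /= !subr0.
have s0 (s t : R) : 0 <= s ^+ 2 + t ^+ 2 by rewrite addr_ge0 ?sqr_ge0.
rewrite -ler_sqr ?nnegrE ?addr_ge0 ?sqrtr_ge0// sqrrD !sqr_sqrtr ?s0//.
have : a * (x - a) + b * (y - b) <=
    Num.sqrt (a ^+ 2 + b ^+ 2) * Num.sqrt ((x - a) ^+ 2 + (y - b) ^+ 2).
  rewrite -sqrtrM ?s0//; apply: (le_trans (ler_norm _)); rewrite -sqrtr_sqr.
  apply: ler_wsqrtr.
  (* Lagrange's identity: this square is the defect in the Cauchy-Schwarz inequality. *)
  by have := sqr_ge0 (a * (y - b) - b * (x - a)); nra.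
rewrite mulr2n; nra.
Qed.

(** [gradient_le_mean_oscillation] for the linear forms X and Y, both bounded by [r] on the closed
    disk. *)
Lemma real_harmonic_gradient u c r : 0 < r -> real_harmonic U u ->
  cdisk c (2 * r) `<=` U ->
  let J g := \int[mu2 R]_(p in odisk c r) g p in
  `|'D_(ex R) u c| * (r / 4 * J (fun=> 1)) <= J (fun p => `|u p - u c|) /\
  `|'D_(ey R) u c| * (r / 4 * J (fun=> 1)) <= J (fun p => `|u p - u c|).
Proof.
move=> r0 [[cu [dx dy [cux [dxx dxy [cuxx _] _]] [cuy [dyx dyy _ [cuyy _]]]]] lap] DU J.
have oU : open U by exact: open_odisk.
have dux p (Up : U p) := is_derive_dx (dx p Up).
have duy p (Up : U p) := is_derive_dy (dy p Up).
have duxx p (Up : U p) := is_derive_dx (dxx p Up).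
have duyy p (Up : U p) := is_derive_dy (dyy p Up).
have H al be := gradient_le_mean_oscillation r0 oU DU dux duy duxx duyy
  cu cux cuy cuxx cuyy lap (al := al) (be := be).
split.
  have := H 1 0; rewrite mul1r mul0r addr0; apply => p.
  by rewrite mul1r mul0r addr0 => /(cdisk_coord (ltW r0))[].
have := H 0 1; rewrite mul1r mul0r add0r; apply => p.
by rewrite mul1r mul0r add0r => /(cdisk_coord (ltW r0))[].
Qed.

Lemma real_harmonic_growth u c r K : 0 < r -> 0 <= K -> real_harmonic U u ->
  odisk c r `<=` U ->
  (forall p, odisk c r p -> `|'D_(ex R) u p| <= K * (r / (r - Num.sqrt (sqdist c p)))) ->
  (forall p, odisk c r p -> `|'D_(ey R) u p| <= K * (r / (r - Num.sqrt (sqdist c p)))) ->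
  forall p, odisk c r p ->
    `|u p - u c| <= 8 * K * r * (r / Num.sqrt (r ^+ 2 - sqdist c p)).
Proof.
move=> r0 K0 [[cu [dx dy [cux _] [cuy _]]] _] DU bx by_.
apply: (@radial_growth R c r K u ('D_(ex R) u) ('D_(ey R) u)) => // p /DU Up.
- exact: is_derive_dx (dx p Up).
- exact: is_derive_dy (dy p Up).
- exact: cux.
- exact: cuy.
Qed.

(** As w(t) / t does not increase, enlarging the argument by a factor costs at most that factor.
    Both implications absorb a change of radius this way. *)
Lemma majorant_scale (w : R -> R) (s t : R) : majorant w -> 0 < s -> s <= t ->
  w t <= t / s * w s.
Proof.
move=> [_ _ _ _ wdec] s0 st; have t0 := lt_le_trans s0 st.
have := wdec s t s0 st; rewrite ler_pdivrMr// => /le_trans; apply.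
by rewrite le_eqVlt; apply/orP; left; apply/eqP; ring.
Qed.

(** The area enters the estimates as a common factor that cancels; a positive finite value suffices
    for that. *)
Lemma odisk_area r c : 0 < r ->
  exists m : R, 0 < m /\ mu2 R (odisk c r) = m%:E.
Proof.
move=> r0; have := mu2_odisk_lty c r; have := mu2_odisk_gt0 c r0.
case: (mu2 R (odisk c r)) => [m||]//; rewrite lte_fin => m0 _.
by exists m.
Qed.

End BlochGrowth.

(** * The two implications for a harmonic mapping *)

Section MeanOscillation.
Variable R : realType.
Set Implicit Arguments.
Unset Strict Implicit.
Variables (w : R -> R) (f : R[i] -> R[i]).
Hypothesis hw : majorant w.
Hypothesis hf : harmonic_mapping (@unit_disk R) f.

Notation U := (odisk (0, 0) 1 : set (R * R)).

Let hRe : real_harmonic U (re_part f).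
Proof. by have [+ _] := hf; rewrite preimage_unit_disk. Qed.

Let hIm : real_harmonic U (im_part f).
Proof. by have [_] := hf; rewrite preimage_unit_disk. Qed.

Let toCK (p : R * R) : ofC (toC p) = p.
Proof. by case: p. Qed.

Let ofCK (z : R[i]) : toC (ofC z) = z.
Proof. by case: z. Qed.

Let osc (z : R[i]) (p : R * R) : R := cabs (f (toC p) - f z).

Let oscE z p : osc z p = Num.sqrt
  ((re_part f p - re_part f (ofC z)) ^+ 2 + (im_part f p - im_part f (ofC z)) ^+ 2).
Proof.
rewrite /osc /re_part /im_part ofCK cabsE.
by case: (f (toC p)) => a b; case: (f z) => a' b'.
Qed.

Let continuous_osc z p : U p -> {for p, continuous (osc z)}.
Proof.
move=> Up.
have cRe : {for p, continuous (re_part f)} by have [[+ _] _] := hRe; exact.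
have cIm : {for p, continuous (im_part f)} by have [[+ _] _] := hIm; exact.
have -> : osc z = Num.sqrt \o (fun p =>
    (re_part f p - re_part f (ofC z)) * (re_part f p - re_part f (ofC z))
  + (im_part f p - im_part f (ofC z)) * (im_part f p - im_part f (ofC z))).
  by apply/funext => q; rewrite oscE !expr2.
apply: continuous_comp; last exact: sqrt_continuous.
by apply: cvgD; apply: cvgM; apply: cvgB; (exact: cvg_cst || assumption).
Qed.

Let cabs_ge0 (z : R[i]) : 0 <= cabs z.
Proof. by rewrite cabsE sqrtr_ge0. Qed.

(** By the triangle inequality |p| <= |z| + |p - z|, while 1 - |z| >= r. *)
Let odisk_sub (z : R[i]) (r : R) p : 0 < r -> r <= 1 - cabs z -> odisk (ofC z) r p ->
  0 < r - Num.sqrt (sqdist (ofC z) p) /\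
  r - Num.sqrt (sqdist (ofC z) p) <= bdist (toC p).
Proof.
move=> r0 rz Dp; have := sqrt_sqdist_triangle (ofC z) p.
rewrite -cabs_ofC -[X in Num.sqrt (sqdist _ X) <= _ -> _]toCK -cabs_ofC => h.
have : Num.sqrt (sqdist (ofC z) p) < r.
  rewrite -ltr_sqr ?nnegrE ?sqrtr_ge0 ?(ltW r0)// sqr_sqrtr//.
  by rewrite addr_ge0 ?sqr_ge0.
by rewrite /bdist; split; lra.
Qed.

Let odisk_unit (z : R[i]) (r : R) p : 0 < r -> r <= 1 - cabs z ->
  odisk (ofC z) r p -> U p.
Proof.
move=> r0 rz Dp; have [h1 h2] := odisk_sub r0 rz Dp.
have : (@toC R @^-1` @unit_disk R) p.
  by rewrite /preimage /unit_disk /mkset; move: h1 h2; rewrite /bdist; lra.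
by rewrite preimage_unit_disk.
Qed.

Let measurable_osc z (r : R) : 0 < r -> r <= 1 - cabs z ->
  measurable_fun (odisk (ofC z) r) (fun p => (osc z p)%:E).
Proof.
move=> r0 rz; apply/measurable_EFinP; apply: continuous_measurable_plane.
  exact: open_odisk.
by move=> p /(odisk_unit r0 rz); exact: continuous_osc.
Qed.

(** The constant 48 is 2 * 8 * 3: real and imaginary parts each grow with the constant 8 of
    [real_harmonic_growth], and [inv_sqrt_integral] contributes 3. *)
Lemma Lambda_bound_mean_oscillation (M : R) (z : R[i]) (r : R) : 0 < M ->
  (forall z, unit_disk z -> Lambda f z <= M * w (1 / bdist z)) ->
  0 < r -> r <= 1 - cabs z ->
  (area_integral (disk z r) (fun zeta => cabs (f zeta - f z)%R)
    / area (disk z r) <= (48 * M * r * w (1 / r))%:E)%E.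
Proof.
move=> M0 HM r0 rz; rewrite /area_integral /area preimage_disk//.
have [_ w0 wmono _ _] := hw.
pose c := ofC z; pose K := M * w (1 / r).
have K0 : 0 <= K by rewrite mulr_ge0 ?(ltW M0)// w0// divr_ge0// ltW.
have DU : odisk c r `<=` U by move=> p; exact: odisk_unit.
have bK p : odisk c r p -> Lambda f (toC p) <=
    K * (r / (r - Num.sqrt (sqdist c p))).
  move=> Dp; have [h1 h2] := odisk_sub r0 rz Dp.
  have b0 := lt_le_trans h1 h2.
  have Up : unit_disk (toC p) by move: b0; rewrite subr_gt0.
  apply: (le_trans (HM _ Up)); rewrite /K -mulrA ler_pM2l//.
  (* Monotonicity of [w] passes from the boundary distance to r - |P|; [majorant_scale] then trades
     1 / (r - |P|) for 1 / r at the cost r / (r - |P|). *)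
  apply: (@le_trans _ _ (w (1 / (r - Num.sqrt (sqdist c p))))).
    apply: wmono; first by rewrite divr_ge0// ltW.
    by rewrite !div1r lef_pV2.
  rewrite [leRHS]mulrC.
  have -> : r / (r - Num.sqrt (sqdist c p))
      = 1 / (r - Num.sqrt (sqdist c p)) / (1 / r) by rewrite !div1r invrK mulrC.
  apply: majorant_scale => //; first by rewrite divr_gt0.
  by rewrite !div1r lef_pV2 ?posrE// gerBl sqrtr_ge0.
have growth u : real_harmonic U u ->
    (forall p, `|'D_(ex R) u p| <= Lambda f (toC p)) ->
    (forall p, `|'D_(ey R) u p| <= Lambda f (toC p)) ->
    forall p, odisk c r p ->
    `|u p - u c| <= 8 * K * r * (r / Num.sqrt (r ^+ 2 - sqdist c p)).
  move=> hu bx by_; apply: real_harmonic_growth => // p Dp.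
    exact: le_trans (bx p) (bK p Dp).
  exact: le_trans (by_ p) (bK p Dp).
have gRe := growth _ hRe.
have gIm := growth _ hIm.
have part p := partials_le_Lambda f (toC p).
have oscb p : odisk c r p ->
    osc z p <= 16 * K * r * (r / Num.sqrt (r ^+ 2 - sqdist c p)).
  move=> Dp; apply: (le_trans (cabs_le _)).
  have -> : complex.Re (f (toC p) - f z) = re_part f p - re_part f c.
    by rewrite /re_part ofCK; case: (f (toC p)) => ? ?; case: (f z).
  have -> : complex.Im (f (toC p) - f z) = im_part f p - im_part f c.
    by rewrite /im_part ofCK; case: (f (toC p)) => ? ?; case: (f z).
  have h1 : `|re_part f p - re_part f c|
      <= 8 * K * r * (r / Num.sqrt (r ^+ 2 - sqdist c p)).
    by apply: gRe => // q; have [] := part q; rewrite toCK.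
  have h2 : `|im_part f p - im_part f c|
      <= 8 * K * r * (r / Num.sqrt (r ^+ 2 - sqdist c p)).
    by apply: gIm => // q; have [] := part q; rewrite toCK.
  by apply: (le_trans (lerD h1 h2)); rewrite le_eqVlt; apply/orP; left; apply/eqP; ring.
have mS : measurable_fun (odisk c r)
    (fun p => (r / Num.sqrt (r ^+ 2 - sqdist c p))%:E).
  apply/measurable_EFinP; apply: continuous_measurable_plane.
    exact: open_odisk.
  move=> p Dp; apply: cvgM; first exact: cvg_cst.
  apply: cvgV; first by rewrite gt_eqF// sqrtr_gt0 subr_gt0.
  apply: (@continuous_comp _ _ _ (fun p => r ^+ 2 - sqdist c p) Num.sqrt).
    by apply: cvgB; [exact: cvg_cst|exact: continuous_sqdist].
  exact: sqrt_continuous.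
have [m [m0 mE]] := odisk_area c r0.
have KR : 0 <= 16 * K * r by apply: mulr_ge0 (ltW r0); apply: mulr_ge0.
have S0 p : odisk c r p -> (0 <= (r / Num.sqrt (r ^+ 2 - sqdist c p))%:E)%E.
  by move=> _; rewrite lee_fin divr_ge0 ?sqrtr_ge0// ltW.
have I1 : (\int[mu2 R]_(p in odisk c r) (osc z p)%:E <=
    (16 * K * r)%:E * (3%:E * mu2 R (odisk c r)))%E.
  apply: (@le_trans _ _ (\int[mu2 R]_(p in odisk c r)
     ((16 * K * r)%:E * (r / Num.sqrt (r ^+ 2 - sqdist c p))%:E))%E).
    apply: ge0_le_integral.
    - exact: measurable_odisk.
    - by move=> p _; rewrite lee_fin; exact: cabs_ge0.
    - exact: measurable_osc.
    - exact: measurable_funeM.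
    - by move=> p /oscb; rewrite -EFinM lee_fin.
  rewrite (ge0_integralZl_EFin _ (measurable_odisk c r) S0 mS KR).
  by rewrite lee_wpmul2l ?lee_fin//; exact: inv_sqrt_integral.
rewrite /planeLebesgue -/c mE inver gt_eqF// lee_pdivrMr//.
apply: (le_trans I1); rewrite mE -!EFinM lee_fin /K.
by rewrite le_eqVlt; apply/orP; left; apply/eqP; ring.
Qed.

(** The constant 48 is 4 * 4 * 3: four partial derivatives, the factor 4 / r of the gradient
    estimate, and w(3 / d) <= 3 w(1 / d). *)
Lemma mean_oscillation_Lambda_bound (M : R) (z : R[i]) : 0 < M ->
  (forall (z : R[i]) (r : R), unit_disk z -> 0 < r -> r <= 1 - cabs z ->
    (area_integral (disk z r) (fun zeta => cabs (f zeta - f z)%R)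
      / area (disk z r) <= (M * r * w (1 / r))%:E)%E) ->
  unit_disk z -> Lambda f z <= 48 * M * w (1 / bdist z).
Proof.
move=> M0 HM Uz.
(* With this radius 2 r < d, so the doubled closed disk stays inside the unit disk. *)
pose c := ofC z; pose d := bdist z; pose r := d / 3.
have d0 : 0 < d by rewrite subr_gt0.
have r0 : 0 < r by rewrite divr_gt0.
have rz : r <= 1 - cabs z by rewrite -/(bdist z) -/d /r; lra.
have DU : cdisk c (2 * r) `<=` U.
  move=> p Dp; apply: (@odisk_unit z d) => //; apply: le_lt_trans Dp _.
  by rewrite /r; nra.
have DrU p : cdisk c r p -> U p.
  move=> Dp; apply: DU; have r2 : r ^+ 2 <= (2 * r) ^+ 2 by nra.
  exact: le_trans Dp r2.
have := HM z r Uz r0 rz; rewrite /area_integral /area preimage_disk//.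
have [m [m0 mE]] := odisk_area c r0.
rewrite /planeLebesgue -/c mE inver gt_eqF// lee_pdivrMr// -EFinM => HI.
have J1 : \int[mu2 R]_(p in odisk c r) 1 = m.
  rewrite /Rintegral (integral_cst _ (measurable_odisk c r)) mul1e.
  exact: (congr1 fine mE).
have K (u : R * R -> R) : real_harmonic U u ->
    (forall p, `|u p - u c| <= osc z p) ->
    `|'D_(ex R) u c| <= 12 * M * w (1 / d) /\ `|'D_(ey R) u c| <= 12 * M * w (1 / d).
  move=> hu uosc.
  have cu p : cdisk c r p -> {for p, continuous u}.
    by move=> /DrU; have [[+ _] _] := hu; exact.
  have ca p : cdisk c r p -> {for p, continuous (fun p => `|u p - u c|)}.
    move=> Dp; apply: cvg_norm; apply: cvgB; last exact: cvg_cst.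
    exact: cu.
  have Ia := odisk_integrable ca.
  have JM : \int[mu2 R]_(p in odisk c r) `|u p - u c| <= M * r * w (1 / r) * m.
    rewrite -lee_fin /Rintegral fineK; last first.
      by apply: integrable_fin_num Ia; exact: measurable_odisk.
    apply: le_trans HI; apply: ge0_le_integral.
    - exact: measurable_odisk.
    - by move=> p _; rewrite lee_fin.
    - by case/integrableP : Ia.
    - exact: measurable_osc.
    - by move=> p _; rewrite lee_fin; exact: uosc.
  have wr : w (1 / r) <= 3 * w (1 / d).
    have -> : 3 = (1 / r) / (1 / d).
      by rewrite /r !div1r invrK invfM invrK mulrAC mulVf ?mul1r// gt_eqF.
    apply: majorant_scale => //; first by rewrite divr_gt0.
    by rewrite !div1r lef_pV2 ?posrE// /r; lra.
  (* Cancelling r m leaves |x| <= 4 M w(1 / r), and [wr] turns 4 into 12. *)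
  have fin (x : R) : `|x| * (r / 4 * m) <= M * r * w (1 / r) * m ->
      `|x| <= 12 * M * w (1 / d).
    rewrite (_ : `|x| * _ = `|x| / 4 * (r * m)); last by ring.
    rewrite (_ : M * r * _ * m = M * w (1 / r) * (r * m)); last by ring.
    rewrite ler_pM2r ?mulr_gt0// => h.
    have : M * w (1 / r) <= M * (3 * w (1 / d)) by rewrite ler_pM2l.
    by lra.
  have [hx hy] := real_harmonic_gradient r0 hu DU.
  rewrite J1 in hx hy.
  by split; apply: fin; [apply: le_trans hx _|apply: le_trans hy _].
apply: (le_trans (Lambda_le_partials f z)).
have [||h1 h2] := K (re_part f) => //.
  move=> p; apply: le_trans (normr_Re_le_cabs _).
  by rewrite /re_part ofCK; case: (f (toC p)) => ? ?; case: (f z).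
have [||h3 h4] := K (im_part f) => //.
  move=> p; apply: le_trans (normr_Im_le_cabs _).
  by rewrite /im_part ofCK; case: (f (toC p)) => ? ?; case: (f z).
by rewrite -/d -/c; lra.
Qed.

End MeanOscillation.

Theorem theorem1 (R : realType) (w : R -> R) (f : R[i] -> R[i])
    (hw : majorant w) (hf : harmonic_mapping (@unit_disk R) f) :
  (exists M : R, 0 < M /\
     forall z : R[i], unit_disk z -> Lambda f z <= M * w (1 / bdist z))
  <->
  (exists M : R, 0 < M /\
     forall (z : R[i]) (r : R), unit_disk z -> 0 < r -> r <= 1 - cabs z ->
       (area_integral (disk z r) (fun zeta : R[i] => cabs (f zeta - f z)%R)
          / area (disk z r) <= (M * r * w (1 / r))%R%:E)%E).
Proof.
(* Both implications multiply the constant by 48. *)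
split=> -[M [M0 HM]]; exists (48 * M); split; rewrite ?mulr_gt0//.
  by move=> z r _ r0 rz; exact: Lambda_bound_mean_oscillation.
by move=> z; exact: mean_oscillation_Lambda_bound.
Qed.
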